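(* For a positive integer $n$ let $e(n)$ be the number of polyominoes with $n$ squares and minimum perimeter $p(n)=2\lceil 2\sqrt{n}\rceil$, where two polyominoes are regarded as equal if they can be mapped onto each other by translations, rotations and reflections. Let $s=\lfloor\sqrt{n}\rfloor$. Define the power series $$a(x)=\prod_{j=1}^\infty\frac{1}{1-x^{j}},\qquad s(x)=1+\sum_{k=1}^\infty x^{k^2}\prod_{j=1}^k\frac{1}{1-x^{2j}},$$ $$r(x)=\frac14\left(a(x)^4+3a(x^2)^2\right),\qquad q(x)=\frac18\left(a(x)^4+3a(x^2)^2+2s(x)^2a(x^2)+2a(x^4)\right),$$ and let $r_k$ and $q_k$ denote the coefficients of $x^k$ in $r(x)$ and $q(x)$, respectively. Then $$e(n)=\begin{cases}1 & \text{if } n=s^2,\\[1mm] \displaystyle\sum_{c=0}^{\left\lfloor -\frac12+\frac12\sqrt{1+4s-4t}\right\rfloor} r_{s-c-c^2-t} & \text{if } n=s^2+t,\ 0<t<s,\\[1mm] 1 & \text{if } n=s^2+s,\\[1mm] \displaystyle q_{s+1-t}+\sum_{c=1}^{\lfloor\sqrt{s+1-t}\rfloor} r_{s+1-c^2-t} & \text{if } n=s^2+s+t,\ 0<t\le s.\end{cases}$$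
   Context: A (square) polyomino of order $n$ is a finite set of $n$ unit squares (cells) of the integer grid in the plane that is connected via shared edges. Its perimeter is the number of unit edges that belong to exactly one of its cells. $p(n)$ denotes the minimum perimeter over all polyominoes with $n$ cells; it is known that $p(n)=2\lceil 2\sqrt{n}\rceil$. *)

(* Defs.v *)
From HB Require Import structures.
From mathcomp Require Import all_boot all_order all_algebra finmap.
From mathcomp Require Import boolp classical_sets cardinality reals.

Set Implicit Arguments.
Unset Strict Implicit.
Unset Printing Implicit Defensive.

Import Order.TTheory GRing.Theory Num.Theory.
Local Open Scope ring_scope.

(* The pair (x, y) stands for the unit square [x, x+1] x [y, y+1]. *)
Notation cell := (int * int)%type.

(* (x, y, true) is the horizontal unit segment from (x, y) to (x+1, y) and
   (x, y, false) is the vertical unit segment from (x, y) to (x, y+1). *)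
Notation edge := (int * int * bool)%type.

Definition cell_edges (c : cell) : {fset edge} :=
  [fset (c.1, c.2, true); (c.1, (c.2 + 1)%R, true);
        (c.1, c.2, false); ((c.1 + 1)%R, c.2, false)]%fset.

Definition share_edge : rel cell :=
  fun c d => (c != d) && (cell_edges c `&` cell_edges d != fset0)%fset.

Definition polyomino (n : nat) (P : {fset cell}) : Prop :=
  #|` P|%fset = n /\
  forall c d : cell, c \in P -> d \in P ->
    exists p : seq cell,
      [/\ path share_edge c p, last c p = d & all (fun x => x \in P) p].

Definition perimeter (P : {fset cell}) : nat :=
  #|` [fset e in \bigcup_(c <- P) cell_edges c
       | #|` [fset c in P | e \in cell_edges c]| == 1%N]|%fset.

Definition is_min_perimeter (n m : nat) : Prop :=
  (exists2 P, polyomino n P & perimeter P = m) /\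
  (forall P, polyomino n P -> (m <= perimeter P)%N).

Definition min_perimeter (n : nat) : nat :=
  xget 0%N [set m | is_min_perimeter n m]%classic.

(* The generators are given by their action on cells, i.e. on the lower left
   corners of the squares: the rotation by 90 degrees (X, Y) |-> (-Y, X) of the
   plane maps [x, x+1] x [y, y+1] onto [-y-1, -y] x [x, x+1], and the reflection
   (X, Y) |-> (-X, Y) maps it onto [-x-1, -x] x [y, y+1]. *)
Inductive grid_isometry : (cell -> cell) -> Prop :=
| Translation (u v : int) : grid_isometry (fun c => (c.1 + u, c.2 + v))
| Rotation : grid_isometry (fun c => (- c.2 - 1, c.1))
| Reflection : grid_isometry (fun c => (- c.1 - 1, c.2))
| Composition f g :
    grid_isometry f -> grid_isometry g -> grid_isometry (fun c => f (g c)).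

Definition congruent (P Q : {fset cell}) : Prop :=
  exists2 f, grid_isometry f & Q = [fset f c | c in P]%fset.

Definition min_polyominoes (n : nat) : set {fset cell} :=
  [set P | polyomino n P /\ perimeter P = min_perimeter n]%classic.

Definition congruence_class (P : {fset cell}) : set {fset cell} :=
  [set Q | congruent P Q]%classic.

(* [fset_set] is the finite set underlying a finite classical set, and is empty
   on an infinite one. *)
Definition num_min_polyominoes (n : nat) : nat :=
  #|` fset_set [set congruence_class P | P in min_polyominoes n]%classic|%fset.

Record fps : Type := FPS { fps_coef : nat -> rat }.

Lemma fps_coefK : cancel fps_coef FPS.
Proof. by case. Qed.

HB.instance Definition _ := Choice.copy fps (can_type fps_coefK).

Lemma fpsP (f g : fps) : fps_coef f =1 fps_coef g <-> f = g.
Proof. by split=> [|->//]; case: f g => f [g] /funext /= ->. Qed.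

Section FpsRing.
Implicit Types f g h : fps.

Definition fps_zero := FPS (fun=> 0).
Definition fps_opp f := FPS (fun k => - fps_coef f k).
Definition fps_add f g := FPS (fun k => fps_coef f k + fps_coef g k).
Definition fps_one := FPS (fun k => (k == 0%N)%:R).
Definition fps_mul f g :=
  FPS (fun k => \sum_(i < k.+1) fps_coef f i * fps_coef g (k - i)%N).

Fact fps_addA : associative fps_add.
Proof. by move=> f g h; apply/fpsP=> k /=; rewrite addrA. Qed.
Fact fps_addC : commutative fps_add.
Proof. by move=> f g; apply/fpsP=> k /=; rewrite addrC. Qed.
Fact fps_add0 : left_id fps_zero fps_add.
Proof. by move=> f; apply/fpsP=> k /=; rewrite add0r. Qed.
Fact fps_addN : left_inverse fps_zero fps_opp fps_add.
Proof. by move=> f; apply/fpsP=> k /=; rewrite addNr. Qed.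

HB.instance Definition _ :=
  GRing.isZmodule.Build fps fps_addA fps_addC fps_add0 fps_addN.

Let trunc n f : {poly rat} := \poly_(i < n.+1) fps_coef f i.

Let coef_trunc n f i : (i <= n)%N -> (trunc n f)`_i = fps_coef f i.
Proof. by move=> le_in; rewrite coef_poly ltnS le_in. Qed.

Let coef_mul n f g i :
  (i <= n)%N -> fps_coef (fps_mul f g) i = (trunc n f * trunc n g)`_i.
Proof.
move=> le_in; rewrite coefM; apply: eq_bigr => -[j /=]; rewrite ltnS => le_ji _.
by rewrite !coef_trunc ?(leq_trans le_ji) // (leq_trans (leq_subr _ _)).
Qed.

Fact fps_mulC : commutative fps_mul.
Proof. by move=> f g; apply/fpsP=> k; rewrite !(@coef_mul k) // mulrC. Qed.

Fact fps_mulA : associative fps_mul.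
Proof.
move=> f g h; apply/fpsP=> k.
transitivity (trunc k f * trunc k g * trunc k h)`_k; last first.
  rewrite coefM; apply: eq_bigr => -[i /=]; rewrite ltnS => le_ik _.
  by rewrite -(@coef_mul k) // coef_trunc // leq_subr.
rewrite -mulrA coefM; apply: eq_bigr => -[i /=]; rewrite ltnS => le_ik _.
by rewrite -(@coef_mul k) ?leq_subr // coef_trunc.
Qed.

Fact fps_mul1 : left_id fps_one fps_mul.
Proof.
move=> f; apply/fpsP=> k /=; rewrite big_ord_recl mul1r subn0 big1 ?addr0 //.
by move=> i _; rewrite mul0r.
Qed.

Fact fps_mulDl : left_distributive fps_mul fps_add.
Proof.
move=> f g h; apply/fpsP=> k /=; rewrite -big_split /=.
by apply: eq_bigr => i _; rewrite mulrDl.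
Qed.

Fact fps_one_neq0 : fps_one != 0.
Proof. by apply/eqP => /fpsP /(_ 0%N). Qed.

HB.instance Definition _ := GRing.Zmodule_isComNzRing.Build fps
  fps_mulA fps_mulC fps_mul1 fps_mulDl fps_one_neq0.

Definition fps_unit : {pred fps} := fun f => `[< exists g, g * f = 1 >].
Definition fps_inv f : fps := xget f [set g | g * f = 1]%classic.

Fact fps_mulVr : {in fps_unit, left_inverse 1 fps_inv *%R}.
Proof. by move=> f /asboolP ex; apply: (xgetPex f ex). Qed.
Fact fps_unitP f g : g * f = 1 -> f \in fps_unit.
Proof. by move=> gf1; apply/asboolP; exists g. Qed.
Fact fps_inv_out : {in [predC fps_unit], fps_inv =1 id}.
Proof. by move=> f /asboolPn nex; apply: xgetPN => g gf; case: nex; exists g. Qed.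

HB.instance Definition _ := GRing.ComNzRing_hasMulInverse.Build fps
  fps_mulVr fps_unitP fps_inv_out.

End FpsRing.

Definition fpsX : fps := FPS (fun k => (k == 1%N)%:R).

(* f(x) |-> f(x^m), for m > 0. *)
Definition fps_subst_Xn (m : nat) (f : fps) : fps :=
  FPS (fun k => if (m %| k)%N then fps_coef f (k %/ m) else 0).

(* The limit in the X-adic topology: each coefficient is eventually constant. *)
Definition fps_lim (u : nat -> fps) : fps :=
  FPS (fun k => xget 0
    [set c | exists N, forall m, (N <= m)%N -> fps_coef (u m) k = c]%classic).

Definition a_series : fps :=
  fps_lim (fun N => \prod_(1 <= j < N.+1) (1 - fpsX ^+ j)^-1).

Definition s_series : fps :=
  1 + fps_lim (fun N => \sum_(1 <= k < N.+1)
        fpsX ^+ (k ^ 2) * \prod_(1 <= j < k.+1) (1 - fpsX ^+ (2 * j))^-1).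

Definition r_series : fps :=
  4%:R^-1 * (a_series ^+ 4 + 3%:R * fps_subst_Xn 2 a_series ^+ 2).

Definition q_series : fps :=
  8%:R^-1 * (a_series ^+ 4 + 3%:R * fps_subst_Xn 2 a_series ^+ 2
             + 2%:R * (s_series ^+ 2 * fps_subst_Xn 2 a_series)
             + 2%:R * fps_subst_Xn 4 a_series).

(* Main.v *)
Require Import Defs.
From HB Require Import structures.
From mathcomp Require Import boolp classical_sets cardinality reals.
From mathcomp Require Import all_boot all_order all_algebra all_fingroup finmap.
From mathcomp Require Import zify ring lra.

Set Implicit Arguments.
Unset Strict Implicit.
Unset Printing Implicit Defensive.

Import Order.TTheory GRing.Theory Num.Theory.
Local Open Scope ring_scope.

(** For any finite set of cells with [w] nonempty columns and [h] nonempty rows,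
    each column contributes at least two horizontal boundary edges and each row
    at least two vertical ones, so the perimeter is at least [2 (w + h)], with
    equality exactly for row- and column-convex sets; connectedness makes the
    nonempty columns and rows consecutive.  As [n <= w h], the minimum perimeter
    is [2 M] with [(M - 1)^2 < 4 n <= M^2], and a minimal polyomino is a convex
    subset of a [w x h] rectangle with [w + h = M] that misses [k = w h - n]
    cells, where [k < min w h].  Hence it contains a full row and a full column,
    and the missing cells form four Young diagrams at the corners.  Conversely
    any four diagrams of total size [k] do not interfere with each other.
    Polyominoes up to congruence are thus the orbits of the symmetries of the
    rectangle on such quadruples, which Burnside's lemma counts: diagrams swapped
    by a symmetry contribute [a (x^2)] or [a (x^4)], and a corner on the axis of a
    diagonal reflection carries a self-conjugate diagram, counted by its Durfee
    square in [s (x)]. *)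

(** * Formal power series *)

(** The strict bound on [k] comes from the minimality of [M]: if the rectangle missed at least
    [min w h] cells, a rectangle with one side shorter by 1 would still have room for [n] cells, and
    its semiperimeter [M - 1] is too small for that. Burnside's lemma is needed for a finite group
    acting on a finite set, so the diagrams are subsets of a [K x K] square. Their generating
    functions agree with [a_series] and [s_series] only below degree [K]; with [K = M] this
    suffices, as [k < M]. Congruence turns into a group orbit only after normalisation: the box is
    placed at the origin with its shorter side first. The index [c] of the final sums is the
    distance of the width from its largest value. For [M = 2 m] the box has area [m^2 - c^2], for
    [M = 2 m + 1] it has area [m^2 + m - c - c^2]. Only an even [M] with [c = 0] gives a square box,
    hence the single coefficient of [q_series]. *)

Lemma fps_coefD f g k : fps_coef (f + g) k = fps_coef f k + fps_coef g k.
Proof. by []. Qed.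

Lemma fps_coefB f g k : fps_coef (f - g) k = fps_coef f k - fps_coef g k.
Proof. by []. Qed.

Lemma fps_coefM f g k :
  fps_coef (f * g) k = \sum_(i < k.+1) fps_coef f i * fps_coef g (k - i).
Proof. by []. Qed.

Lemma fps_coef_sum (I : Type) (r : seq I) (P : pred I) (F : I -> fps) k :
  fps_coef (\sum_(i <- r | P i) F i) k = \sum_(i <- r | P i) fps_coef (F i) k.
Proof. by elim/big_rec2: _ => // i y x _ <-. Qed.

Lemma fps_coefMn f m k : fps_coef (f *+ m) k = fps_coef f k *+ m.
Proof. by elim: m => // m IHm; rewrite !mulrS fps_coefD IHm. Qed.

Lemma fps_coefXnM m f k :
  fps_coef (fpsX ^+ m * f) k = if (m <= k)%N then fps_coef f (k - m) else 0.
Proof.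
elim: m f k => [|m IHm] f k; first by rewrite mul1r subn0.
rewrite exprSr -mulrA IHm; case: (leqP m k) => [lmk|lkm]; last by rewrite ifN //; lia.
rewrite fps_coefM; case: (ltnP m k) => [ltmk|lekm].
  have lt1 : (1 < (k - m).+1)%N by lia.
  rewrite (bigD1 (Ordinal lt1)) //= mul1r big1 ?addr0; first by congr fps_coef; lia.
  by move=> i /eqP ni; case: eqP => [i1|]; [case: ni; apply/val_inj|rewrite mul0r].
rewrite big1 // => i _ /=; case: eqP => [i1|]; last by rewrite mul0r.
by have := ltn_ord i; rewrite i1; lia.
Qed.

(** The inverse is the geometric series, with coefficient 1 exactly at the multiples of [j]. *)
Lemma fps_unit_1subXn j : (0 < j)%N -> 1 - fpsX ^+ j \is a GRing.unit.
Proof.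
move=> j0; suff e : FPS (fun k => (j %| k)%N%:R) * (1 - fpsX ^+ j) = 1.
  exact: fps_unitP e.
apply/fpsP => k; rewrite mulrBr mulr1 mulrC fps_coefB fps_coefXnM /=.
case: leqP => [lejk|ltkj].
  rewrite dvdn_subl ?dvdnn // subrr; case: k lejk => // h; lia.
rewrite subr0; case: k ltkj => [|k] ltkj; first by rewrite dvdn0.
by rewrite gtnNdvd.
Qed.

(** From [1 / (1 - x^j) = 1 + x^j / (1 - x^j)]. This recursion is all that is ever used about the
    inverses, and the counts of diagrams will satisfy the same one. *)
Lemma fps_coef_geom j f k : (0 < j)%N ->
  fps_coef (f * (1 - fpsX ^+ j)^-1) k = fps_coef f k +
    (if (j <= k)%N then fps_coef (f * (1 - fpsX ^+ j)^-1) (k - j) else 0).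
Proof.
move=> j0; rewrite -fps_coefXnM -fps_coefD; congr fps_coef.
by apply: (mulIr (fps_unit_1subXn j0)); rewrite mulrDl mulrA !divrK ?fps_unit_1subXn //; ring.
Qed.

(** [fps_lim] picks some eventual value of the coefficient, and two eventual values agree far enough
    along the sequence. *)
Lemma fps_coef_lim u k c N :
  (forall m, (N <= m)%N -> fps_coef (u m) k = c) -> fps_coef (fps_lim u) k = c.
Proof.
move=> uc; rewrite /=; case: xgetP => [_ -> [N' h]|/(_ c)[]]; last by exists N.
by rewrite -(uc (maxn N N')) ?leq_maxl // h // leq_maxr.
Qed.

Lemma fps_unit_nat m : (0 < m)%N -> m%:R \is a @GRing.unit fps.
Proof.
move=> m0; have e : FPS (fun k => if k == 0%N then m%:R^-1 else 0) * m%:R = 1 :> fps.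
  apply/fpsP => k; rewrite mulr_natr fps_coefMn /=.
  case: eqP => _; last by rewrite mul0rn.
  by rewrite -[_^-1 *+ m]mulr_natr mulVf // pnatr_eq0 -lt0n.
exact: fps_unitP e.
Qed.

Lemma fps_coef_natdiv m f k : (0 < m)%N ->
  fps_coef (m%:R^-1 * f) k = fps_coef f k / m%:R.
Proof.
move=> m0; have m0' : m%:R != 0 :> rat by rewrite pnatr_eq0 -lt0n.
apply: (mulIf m0'); rewrite divfK // mulr_natr -fps_coefMn -(mulr_natl (m%:R^-1 * f)).
by rewrite mulrA mulrV ?mul1r ?fps_unit_nat.
Qed.

(** The generating function of partitions into parts at most [N], taken at [x^m]: [m = 1] occurs in
    [a_series], [m = 2] in [s_series]. *)
Definition part_series (m N : nat) : fps :=
  \prod_(1 <= j < N.+1) (1 - fpsX ^+ (m * j))^-1.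

Lemma coef_part_series0 m k : fps_coef (part_series m 0) k = (k == 0%N)%:R.
Proof. by rewrite /part_series big_geq. Qed.

Lemma coef_part_seriesS m N k : (0 < m)%N ->
  fps_coef (part_series m N.+1) k = fps_coef (part_series m N) k +
    (if (m * N.+1 <= k)%N then fps_coef (part_series m N.+1) (k - m * N.+1)
     else 0).
Proof.
move=> m0; have -> : part_series m N.+1 =
    part_series m N * (1 - fpsX ^+ (m * N.+1))^-1.
  by rewrite /part_series big_nat_recr.
by apply: fps_coef_geom; rewrite muln_gt0 m0.
Qed.

Lemma coef_part_series_dilate m N k : (0 < m)%N ->
  fps_coef (part_series m N) k =
  if (m %| k)%N then fps_coef (part_series 1 N) (k %/ m) else 0.
Proof.
move=> m0; elim: N k => [|N IHN] k.
  rewrite !coef_part_series0; case: ifP => [/dvdnP[q ->]|].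
    by rewrite mulnK // muln_eq0 (gtn_eqF m0) orbF.
  by case: eqP => // ->; rewrite dvdn0.
elim/ltn_ind: k => k IHk.
rewrite coef_part_seriesS // IHN; case: leqP => [le|lt].
  rewrite IHk; last by rewrite ltn_subrL; lia.
  rewrite dvdn_subl ?dvdn_mulr //; case: ifP => [mk|]; last by rewrite addr0.
  rewrite [in RHS]coef_part_seriesS // !mul1n leq_divRL // [(N.+1 * m)%N]mulnC le.
  congr (_ + fps_coef _ _).
  by case/dvdnP: mk => q ->; rewrite [(m * _)%N]mulnC -mulnBl !mulnK.
rewrite addr0; case: ifP => // mk.
by rewrite [in RHS]coef_part_seriesS // !mul1n leq_divRL // [(N.+1 * m)%N]mulnC leqNgt lt addr0.
Qed.

(** A factor of index greater than [k] is 1 up to terms of degree greater than [k]. *)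
Lemma coef_part_series_stable m k N : (k <= N)%N -> (0 < m)%N ->
  fps_coef (part_series m N) k = fps_coef (part_series m k) k.
Proof.
move=> leN m0; rewrite -(subnKC leN); elim: (N - k)%N => [|d IHd].
  by rewrite addn0.
rewrite addnS coef_part_seriesS // IHd ifN ?addr0 //; nia.
Qed.

Lemma coef_a_series k N : (k <= N)%N ->
  fps_coef a_series k = fps_coef (part_series 1 N) k.
Proof.
move=> leN; rewrite coef_part_series_stable //.
apply: (@fps_coef_lim _ _ _ k) => m lem.
rewrite -(coef_part_series_stable lem) //; congr fps_coef.
by apply: eq_bigr => j _; rewrite mul1n.
Qed.

(** The leading 1 of [s_series] becomes the term [k = 0], the empty Durfee square; terms with
    [k > j] start in degree [k^2 > j]. *)
Lemma coef_s_series j N : (j <= N)%N ->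
  fps_coef s_series j = \sum_(0 <= k < N.+1)
    (if (k ^ 2 <= j)%N && (2 %| j - k ^ 2)%N
     then fps_coef (part_series 1 k) ((j - k ^ 2) %/ 2) else 0).
Proof.
move=> leN; rewrite fps_coefD big_nat_recl //; congr (_ + _).
  rewrite exp0n // subn0 coef_part_series0 /=; case: ifP => [/dvdnP[q ->]|].
    by rewrite mulnK // muln_eq0 orbF.
  by case: j {leN} => //.
have E k : fps_coef (fpsX ^+ (k ^ 2) *
      \prod_(1 <= j < k.+1) (1 - fpsX ^+ (2 * j))^-1) j =
    if (k ^ 2 <= j)%N && (2 %| j - k ^ 2)%N
    then fps_coef (part_series 1 k) ((j - k ^ 2) %/ 2) else 0.
  rewrite -[\prod_(_ <= _ < _) _]/(part_series 2 k) fps_coefXnM.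
  by case: leqP => // _; rewrite coef_part_series_dilate.
apply: (@fps_coef_lim _ _ _ N) => m lem; rewrite fps_coef_sum.
rewrite (eq_bigr _ (fun k _ => E k)) big_add1 (big_cat_nat (n := N)) //=.
rewrite [X in _ + X]big_nat_cond [X in _ + X]big1 ?addr0 //.
by move=> k /andP[/andP[h _] _]; rewrite ifN //; apply/negP => /andP[]; nia.
Qed.

(** * Generating functions of finite types *)

Definition gfun (T : finType) (P : pred T) (sz : T -> nat) : fps :=
  FPS (fun k => #|[pred x | P x && (sz x == k)]|%:R).

Lemma gfun_bij (T U : finType) (P : pred T) (Q : pred U) sz sz'
    (f : T -> U) (g : U -> T) :
  (forall x, P x -> [/\ Q (f x), g (f x) = x & sz' (f x) = sz x]) ->
  (forall y, Q y -> P (g y) /\ f (g y) = y) ->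
  gfun P sz = gfun Q sz'.
Proof.
move=> hf hg; apply/fpsP => k /=; congr _%:R.
rewrite -(@card_in_image _ _ f [pred x | P x && (sz x == k)]); last first.
  move=> x y /andP[/hf[_ gx _] _] /andP[/hf[_ gy _] _] e.
  by rewrite -gx e gy.
apply: eq_card => y; apply/fintype.imageP/andP => [[x /andP[/hf[Qx _ sx] /eqP <-] ->]|].
  by split=> //; apply/eqP.
case=> Qy /eqP <-; have [Py fy] := hg y Qy; exists (g y) => //.
by rewrite inE Py; have [_ _ <-] := hf _ Py; rewrite fy eqxx.
Qed.

Lemma gfunM (T U : finType) (P : pred T) (Q : pred U) sz sz' :
  gfun P sz * gfun Q sz' =
  gfun [pred p : T * U | P p.1 && Q p.2] (fun p => sz p.1 + sz' p.2)%N.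
Proof.
apply/fpsP => k; rewrite fps_coefM /= -sum1_card natr_sum.
(* The pairs are sorted by the size of their first component. The default value of [inord] never
   occurs, since the total size [k] bounds that component. *)
rewrite (partition_big (fun p : T * U => inord (sz p.1) : 'I_k.+1) xpredT) //=.
apply: eq_bigr => i _; rewrite -natrM -cardX -sum1_card natr_sum.
apply: eq_bigl => -[x y]; rewrite !inE /=.
case: (P x) => //=; case: (Q y) => //=; last by rewrite andbF.
apply/andP/andP => [[/eqP ex /eqP ey]|[/eqP e /eqP ei]].
  split; first by rewrite ex ey; apply/eqP; have := ltn_ord i; lia.
  by apply/eqP/val_inj; rewrite /= inordK ex.
by rewrite -ei inordK; lia.
Qed.

(** Meant for [m] corners that a symmetry permutes cyclically: one diagram is free and its size
    counts [m] times. *)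
Lemma gfun_dilate (T : finType) (P : pred T) sz m : (0 < m)%N ->
  gfun P (fun x => m * sz x)%N = fps_subst_Xn m (gfun P sz).
Proof.
move=> m0; apply/fpsP => k /=; case: ifP => [/dvdnP[q ->]|ndv].
  congr _%:R; apply: eq_card => x.
  by rewrite !inE mulnK // [(q * m)%N]mulnC eqn_pmul2l.
rewrite [X in X%:R](_ : _ = 0%N) //; apply: eq_card0 => x; rewrite !inE.
by apply/negbTE/negP => /andP[_ /eqP e]; rewrite -e dvdn_mulr in ndv.
Qed.

(** Congruence modulo [x^K], the precision to which diagrams inside a [K x K] square represent all
    diagrams. *)
Definition fps_eqmod (K : nat) (f g : fps) : Prop :=
  forall k, (k < K)%N -> fps_coef f k = fps_coef g k.

Lemma fps_eqmodD K f f' g g' :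
  fps_eqmod K f f' -> fps_eqmod K g g' -> fps_eqmod K (f + g) (f' + g').
Proof. by move=> hf hg k kK; rewrite !fps_coefD hf ?hg. Qed.

Lemma fps_eqmodM K f f' g g' :
  fps_eqmod K f f' -> fps_eqmod K g g' -> fps_eqmod K (f * g) (f' * g').
Proof.
move=> hf hg k kK; rewrite !fps_coefM; apply: eq_bigr => i _.
by have := ltn_ord i => hi; rewrite hf ?hg //; lia.
Qed.

Lemma fps_eqmod_subst K m f f' : (0 < m)%N ->
  fps_eqmod K f f' -> fps_eqmod K (fps_subst_Xn m f) (fps_subst_Xn m f').
Proof.
move=> m0 hf k kK /=; case: ifP => // _; apply: hf.
exact: leq_ltn_trans (leq_div _ _) kK.
Qed.

(** * Young diagrams *)

Section YoungDiagrams.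
Variable K : nat.

Definition ydiag := {set 'I_K * 'I_K}.
Implicit Types A B : ydiag.

(** Natural coordinates, with the value false outside the square, let shifts and reflections be
    written without proofs of bounds. *)
Definition ymem (A : ydiag) (x y : nat) : bool :=
  [exists p in A, (p.1 == x :> nat) && (p.2 == y :> nat)].

Definition yof (P : nat -> nat -> bool) : ydiag := [set p : 'I_K * 'I_K | P p.1 p.2].

Lemma ymem_lt A x y : ymem A x y -> (x < K)%N /\ (y < K)%N.
Proof.
by case/existsP => p /and3P[_ /eqP <- /eqP <-]; rewrite !ltn_ord.
Qed.

Lemma ymem_ord A (i j : 'I_K) : ymem A i j = ((i, j) \in A).
Proof.
apply/existsP/idP => [[[i' j'] /and3P[h /eqP/val_inj + /eqP/val_inj]]|h].
  by move=> /= <- <-.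
by exists (i, j); rewrite h !eqxx.
Qed.

Lemma ymem_of P x y : ymem (yof P) x y = [&& (x < K)%N, (y < K)%N & P x y].
Proof.
apply/idP/and3P => [h|[hx hy]].
  have [hx hy] := ymem_lt h; split=> //.
  by rewrite (ymem_ord _ (Ordinal hx) (Ordinal hy)) inE in h.
by rewrite (ymem_ord _ (Ordinal hx) (Ordinal hy)) inE.
Qed.

Lemma ymem_inj A B : ymem A =2 ymem B -> A = B.
Proof. by move=> h; apply/setP => -[i j]; rewrite -!ymem_ord h. Qed.

Lemma card_ymem A : #|A| = (\sum_(0 <= x < K) \sum_(0 <= y < K) ymem A x y)%N.
Proof.
rewrite big_mkord (eq_bigr (fun i : 'I_K => \sum_(j < K) ymem A i j)%N).
  rewrite pair_big /= -sum1_card big_mkcond /=; apply: eq_bigr => -[i j] _.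
  by rewrite ymem_ord; case: (_ \in _).
by move=> i _; rewrite big_mkord.
Qed.

Lemma card_ymem_le A w h :
  (forall x y, ymem A x y -> (x < w)%N /\ (y < h)%N) ->
  #|A| = (\sum_(0 <= x < w) \sum_(0 <= y < h) ymem A x y)%N.
Proof.
have ext (F : nat -> nat) a b : (a <= b)%N ->
    (forall x, (a <= x)%N -> F x = 0%N) ->
    (\sum_(0 <= x < b) F x = \sum_(0 <= x < a) F x)%N.
  move=> ab F0; rewrite (big_cat_nat (n := a)) //= [X in (_ + X)%N]big_nat_cond.
  by rewrite [X in (_ + X)%N]big1 ?addn0 // => x /andP[/andP[/F0]].
(* The sides [w] and [h] may be smaller or larger than [K], so both sums are compared with the one
   over a common larger square. *)
move=> hA; pose m := maxn K (maxn w h).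
have E w' h' : (w' <= m)%N -> (h' <= m)%N ->
    (forall x y, ymem A x y -> (x < w')%N /\ (y < h')%N) ->
    (\sum_(0 <= x < m) \sum_(0 <= y < m) ymem A x y =
     \sum_(0 <= x < w') \sum_(0 <= y < h') ymem A x y)%N.
  move=> wm hm hwh; rewrite (ext _ w') //.
    apply: eq_bigr => x _; apply: ext => // y hy.
    by case: (boolP (ymem _ _ _)) => // /hwh[]; lia.
  move=> x hx; apply: big1 => y _.
  by case: (boolP (ymem _ _ _)) => // /hwh[]; lia.
rewrite card_ymem -(E w h) -1?(E K K) //; try by move=> *; rewrite /m; lia.
by move=> x y; exact: ymem_lt.
Qed.

Definition young (A : ydiag) : bool :=
  `[< forall x y x' y', (x' <= x)%N -> (y' <= y)%N ->
        ymem A x y -> ymem A x' y' >].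

Lemma youngP A x y x' y' : young A -> ymem A x y ->
  (x' <= x)%N -> (y' <= y)%N -> ymem A x' y'.
Proof. by move=> /asboolP h m hx hy; exact: h m. Qed.

Definition ytr A := yof (fun x y => ymem A y x).

Lemma ymem_tr A x y : ymem (ytr A) x y = ymem A y x.
Proof.
rewrite ymem_of; case: (boolP (ymem A y x)); rewrite ?andbF //.
by move=> /ymem_lt[-> ->].
Qed.

Lemma ytrK : involutive ytr.
Proof. by move=> A; apply: ymem_inj => x y; rewrite !ymem_tr. Qed.

Lemma young_tr A : young (ytr A) = young A.
Proof.
have h B : young B -> young (ytr B).
  move=> yB; apply/asboolP => x y x' y' lx ly; rewrite !ymem_tr => m.
  exact: youngP yB m ly lx.
by apply/idP/idP => [/h|/h//]; rewrite ytrK.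
Qed.

Lemma card_ytr A : #|ytr A| = #|A|.
Proof.
rewrite !card_ymem exchange_big /=.
by apply: eq_bigr => x _; apply: eq_bigr => y _; rewrite ymem_tr.
Qed.

(** The cells [(0, y), ..., (x, y)] all belong to [A]. *)
Lemma young_ltx A x y : young A -> ymem A x y -> (x < #|A|)%N.
Proof.
move=> yA m; have [xK yK] := ymem_lt m.
have hi (i : 'I_x.+1) : (i < K)%N by exact: leq_ltn_trans (leq_ord i) xK.
pose f (i : 'I_x.+1) := (Ordinal (hi i), Ordinal yK).
have inj : injective f by move=> i j [/val_inj].
rewrite -[X in (X <= _)%N]card_ord -(card_codom inj).
apply/subset_leq_card/fintype.subsetP => p /codomP[i ->].
by rewrite -ymem_ord; exact: youngP yA m (leq_ord i) (leqnn _).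
Qed.

Lemma young_lty A x y : young A -> ymem A x y -> (y < #|A|)%N.
Proof.
by move=> yA m; rewrite -card_ytr; apply: (@young_ltx _ y x);
  rewrite ?young_tr ?ymem_tr.
Qed.

(** * Counting diagrams with a bounded number of columns *)

Definition ycols (N : nat) (A : ydiag) : bool :=
  `[< forall x y, ymem A x y -> (x < N)%N >].

Lemma ycolsP N A x y : ycols N A -> ymem A x y -> (x < N)%N.
Proof. by move=> /asboolP h; exact: h. Qed.

Lemma card_ycols N A : ycols N A -> (N <= K)%N ->
  #|A| = (\sum_(0 <= x < N) \sum_(0 <= y < K) ymem A x y)%N.
Proof.
move=> /asboolP h NK; apply: card_ymem_le => x y m; split; first exact: h m.
by case/ymem_lt: m.
Qed.

Lemma sum_ymem_shift A x :
  (\sum_(0 <= y < K) ymem A x y =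
   ymem A x 0 + \sum_(0 <= y < K) ymem A x y.+1)%N.
Proof.
rewrite -(big_nat_recl K 0 (fun y => ymem A x y : nat)) // big_nat_recr //=.
have -> : ymem A x K = false by apply/negbTE/negP => /ymem_lt[_]; rewrite ltnn.
by rewrite addn0.
Qed.


Lemma ycols0 A : ycols 0 A = (A == set0).
Proof.
apply/asboolP/eqP => [h|-> x y /existsP[p]]; last by rewrite in_set0.
by apply/setP => -[i j]; rewrite -ymem_ord in_set0; apply/negbTE/negP => /h.
Qed.

Lemma young_set0 : young set0.
Proof. by apply/asboolP => x y x' y' _ _ /existsP[p]; rewrite in_set0. Qed.

Definition ycount N j : nat := #|[set A : ydiag | [&& young A, ycols N A & #|A| == j]]|.

Lemma ycount0 j : ycount 0 j = (j == 0%N).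
Proof.
rewrite /ycount; case: eqP => [->|j0] /=; last first.
  apply: eq_card0 => A; rewrite inE; apply/negbTE/negP => /and3P[_].
  by rewrite ycols0 => /eqP -> /eqP e; apply: j0; rewrite -e cards0.
rewrite -(cards1 (set0 : ydiag)); apply: eq_card => A; rewrite !inE ycols0.
by apply/and3P/eqP => [[_ /eqP]//|->]; rewrite cards0 young_set0.
Qed.

(* Split on whether column N is empty; if it is not, remove the bottom row, which
   has N+1 cells. *)
Lemma ycountS N j : (N < K)%N -> (j < K)%N ->
  ycount N.+1 j =
  (ycount N j + if N < j then ycount N.+1 (j - N.+1) else 0)%N.
Proof.
move=> NK jK; rewrite /ycount.
set S := [set A : ydiag | _]; rewrite -(cardsID [set A : ydiag | ymem A N 0] S) addnC.
congr (_ + _)%N.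
  apply: eq_card => A; rewrite !inE; apply/andP/and3P.
    case=> nm /and3P[yA /asboolP cA ->]; split=> //.
    apply/asboolP => x y m; move: (cA _ _ m); rewrite ltnS leq_eqVlt.
    by case/orP => // /eqP ex; rewrite -ex (youngP yA m) in nm.
  case=> yA /asboolP cA ->; rewrite yA; split=> //.
    by apply/negP => /cA; rewrite ltnn.
  by rewrite andbT; apply/asboolP => x y /cA /ltnW.
have row0 A : young A -> ycols N.+1 A -> ymem A N 0 ->
    forall x, ymem A x 0 = (x < N.+1)%N.
  move=> yA /asboolP cA m x; apply/idP/idP => [/cA//|xN].
  exact: youngP yA m _ _.
pose down A := yof (fun x y => ymem A x y.+1).
have downE A x y : ymem (down A) x y = ymem A x y.+1.
  rewrite ymem_of; case: (boolP (ymem A x y.+1)); rewrite ?andbF //.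
  by move=> /ymem_lt[-> /ltnW ->].
have cdown A : young A -> ycols N.+1 A -> ymem A N 0 ->
    #|A| = (N.+1 + #|down A|)%N.
  move=> yA cA m; have dA : ycols N.+1 (down A).
    by apply/asboolP => x y; rewrite downE => h; exact: ycolsP cA h.
  rewrite (card_ycols cA) // (card_ycols dA) //.
  rewrite (eq_bigr _ (fun x _ => sum_ymem_shift A x)) big_split /=; congr (_ + _)%N.
    rewrite big_mkord (eq_bigr (fun=> 1%N)); first by rewrite sum1_card card_ord.
    by move=> i _; rewrite (row0 A) // ltn_ord.
  by apply: eq_bigr => x _; apply: eq_bigr => y _; rewrite downE.
have injd : {in S :&: [set A : ydiag | ymem A N 0] &, injective down}.
  move=> A B; rewrite !inE => /andP[/and3P[yA cA _] mA] /andP[/and3P[yB cB _] mB].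
  move=> e; apply: ymem_inj => x [|y]; first by rewrite (row0 A) // (row0 B).
  by rewrite -!downE e.
case: ltnP => [Nj|jN]; last first.
  apply: eq_card0 => A; rewrite !inE; apply/negbTE/negP => /andP[/and3P[yA cA /eqP e] m].
  by move: (cdown A yA cA m); lia.
rewrite -(card_in_imset injd); apply: eq_card => B; rewrite inE.
apply/imsetP/and3P => [[A]|[yB cB /eqP eB]].
  rewrite !inE => /andP[/and3P[yA cA /eqP e] m] ->; split.
  - apply/asboolP => x y x' y' hx hy; rewrite !downE => h.
    exact: youngP yA h hx _.
  - by apply/asboolP => x y; rewrite downE => h; exact: ycolsP cA h.
  - by apply/eqP; rewrite -e (cdown A) // addKn.
(* There is room for the new bottom row: the height of [B] is at most its size [j - N.+1], and
   [j < K]. *)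
have topB x y : ymem B x y -> (y.+1 < K)%N.
  by move=> h; have := young_lty yB h; lia.
pose A := yof (fun x y => (x < N.+1)%N && (if y is y'.+1 then ymem B x y' else true)).
have A0 x : ymem A x 0 = (x < N.+1)%N.
  by rewrite ymem_of andbT; apply/and3P/idP => [[]//|h]; split; lia.
have AS x y : ymem A x y.+1 = ymem B x y.
  rewrite ymem_of; apply/and4P/idP => [[]//|h]; split=> //.
  - by case/ymem_lt: h.
  - exact: topB h.
  - by exact: ycolsP cB h.
have cA : ycols N.+1 A by apply/asboolP => x y; rewrite ymem_of => /and4P[].
have yA : young A.
  apply/asboolP => x y x' y' hx hy h.
  have xN : (x < N.+1)%N by exact: ycolsP cA h.
  case: y' hy => [|y'] hy; first by rewrite A0; lia.
  case: y hy h => // y hy; rewrite !AS => h; exact: youngP yB h _ _.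
have mA : ymem A N 0 by rewrite A0.
have e : B = down A by apply: ymem_inj => x y; rewrite downE AS.
exists A => //; rewrite !inE yA cA mA andbT /=.
by rewrite (cdown A) // -e eB subnKC.
Qed.

(** [ycountS] and [coef_part_seriesS] with [m = 1] are the same recursion, with the same values at
    [N = 0]. *)
Lemma coef_ycount N j : (N <= K)%N -> (j < K)%N ->
  (ycount N j)%:R = fps_coef (part_series 1 N) j.
Proof.
elim: N j => [|N IHN] j NK; first by rewrite ycount0 coef_part_series0.
elim/ltn_ind: j => j IHj jK; rewrite ycountS // natrD IHN ?(ltnW NK) //.
rewrite coef_part_seriesS // mul1n; congr (_ + _).
by case: (ltnP N j) => // Nj; apply: IHj; lia.
Qed.

Lemma gfun_young : fps_eqmod K (gfun young (fun A => #|A|)) a_series.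
Proof.
move=> k kK; rewrite (coef_a_series (ltnW kK)) -coef_ycount //; congr _%:R.
apply: eq_card => A; rewrite !inE; case: young => //=; case: eqP => _.
  by rewrite andbT; apply/esym/asboolP => x y /ymem_lt[].
by rewrite andbF.
Qed.

(** * Self-conjugate diagrams and their Durfee squares *)

Definition selfconj (A : ydiag) := young A && (ytr A == A).

Lemma selfconj_sym A x y : selfconj A -> ymem A x y = ymem A y x.
Proof. by case/andP => _ /eqP e; rewrite -{1}e ymem_tr. Qed.

(** The Durfee square is read off the diagonal: a Young diagram contains the cell [(x, x)] exactly
    when it contains the square of side [x + 1]. *)
Definition durfee k (A : ydiag) : bool := `[< forall x, ymem A x x = (x < k)%N >].

Lemma ex_durfee A : young A -> exists k, durfee k A.
Proof.
move=> yA; have ex : exists k, ~~ ymem A k k.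
  by exists K; apply/negP => /ymem_lt[]; rewrite ltnn.
exists (ex_minn ex); case: ex_minnP => k nk mink; apply/asboolP => x.
apply/idP/idP => [m|lt]; last by apply: contraTT lt => /mink; rewrite leqNgt.
by rewrite ltnNge; apply/negP => h; move: nk; rewrite (youngP yA m).
Qed.

Lemma durfee_uniq A k k' : durfee k A -> durfee k' A -> k = k'.
Proof.
move=> /asboolP h /asboolP h'.
have e x : (x < k)%N = (x < k')%N by rewrite -h h'.
by have := e k; have := e k'; rewrite !ltnn; case: (ltngtP k k').
Qed.

Lemma durfee_le A k : young A -> durfee k A -> (k <= #|A|)%N.
Proof.
case: k => // k yA /asboolP h; apply: (young_ltx (y := k) yA).
by rewrite h.
Qed.

(* A self-conjugate diagram with Durfee square of side k is the square together
   with a diagram with at most k columns above it and the mirror image of that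
   diagram to its right. *)
Lemma card_durfee k j : (j < K)%N -> (k <= j)%N ->
  #|[set A : ydiag | [&& selfconj A, durfee k A & #|A| == j]]| =
  (if (k ^ 2 <= j) && (2 %| j - k ^ 2) then ycount k ((j - k ^ 2) %/ 2) else 0)%N.
Proof.
move=> jK kj; set S := [set A : ydiag | _].
pose up A := yof (fun x y => (x < k)%N && ymem A x (y + k)).
have upE A x y : ymem (up A) x y = (x < k)%N && ymem A x (y + k).
  rewrite ymem_of; case: (ltnP x k); rewrite ?andbF //= => _.
  case: (boolP (ymem A x _)); rewrite ?andbF //.
  by move=> /ymem_lt[-> h] /=; rewrite andbT; lia.
have cup A : selfconj A -> durfee k A -> #|A| = (k ^ 2 + 2 * #|up A|)%N.
  move=> sA /asboolP dA; have /andP[yA _] := sA.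
  have cu : ycols k (up A) by apply/asboolP => x y; rewrite upE => /andP[].
  have lo x y : (x < k)%N -> (y < k)%N -> ymem A x y.
    move=> hx hy; have m : ymem A (maxn x y) (maxn x y) by rewrite dA gtn_max hx hy.
    by apply: youngP yA m _ _; lia.
  have hi x y : (k <= x)%N -> (k <= y)%N -> ymem A x y = false.
    move=> hx hy; apply/negbTE/negP => m; have : ymem A k k by exact: youngP yA m _ _.
    by rewrite dA ltnn.
  have eu : #|up A| = (\sum_(0 <= x < k) \sum_(k <= y < K) ymem A x y)%N.
    rewrite (@card_ymem_le _ k (K - k)); last first.
      by move=> x y; rewrite upE => /andP[-> /ymem_lt[_]]; lia.
    rewrite [LHS]big_nat_cond [RHS]big_nat_cond.
    apply: eq_bigr => x /andP[/andP[_ xk] _].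
    rewrite -{2}[k]add0n big_addn; apply: eq_bigr => y _.
    by rewrite upE xk.
  rewrite card_ymem (big_cat_nat (n := k)) //=; last lia.
  have -> : (\sum_(0 <= x < k) \sum_(0 <= y < K) ymem A x y =
             k ^ 2 + #|up A|)%N.
    rewrite eu.
    have -> : (\sum_(0 <= x < k) \sum_(0 <= y < K) ymem A x y =
       \sum_(0 <= x < k) (k + \sum_(k <= y < K) ymem A x y))%N.
      rewrite [LHS]big_nat_cond [RHS]big_nat_cond.
      apply: eq_bigr => x /andP[/andP[_ xk] _].
      rewrite (big_cat_nat (n := k)) //=; last lia.
      congr (_ + _)%N; transitivity (\sum_(0 <= y < k) 1)%N; last first.
        by rewrite sum_nat_const_nat subn0 muln1.
      rewrite [LHS]big_nat_cond [RHS]big_nat_cond.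
      by apply: eq_bigr => y /andP[/andP[_ yk] _]; rewrite lo.
    by rewrite big_split /= sum_nat_const_nat subn0 mulnn.
  (* The cells to the right of the square are the mirror image of those above it, and beyond the
     square in both coordinates there are none. *)
  have -> : (\sum_(k <= x < K) \sum_(0 <= y < K) ymem A x y = #|up A|)%N.
    rewrite eu [RHS]exchange_big /= [LHS]big_nat_cond [RHS]big_nat_cond.
    apply: eq_bigr => x /andP[/andP[kx _] _].
    rewrite (big_cat_nat (n := k)) //=; last lia.
    rewrite [X in (_ + X)%N]big_nat_cond [X in (_ + X)%N]big1 ?addn0.
      by apply: eq_bigr => y _; rewrite selfconj_sym.
    by move=> y /andP[/andP[ky _] _]; rewrite hi.
  by rewrite mul2n -addnn addnA.
have injd : {in S &, injective up}.
  move=> A B; rewrite !inE => /and3P[sA /asboolP dA _] /and3P[sB /asboolP dB _] e.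
  have /andP[yA _] := sA; have /andP[yB _] := sB.
  (* By symmetry it suffices to look on and above the diagonal, where a cell is either in the
     square, or has [x >= k] and is absent, or is recorded by [up]. *)
  have H x y : (x <= y)%N -> ymem A x y = ymem B x y.
    move=> xy; case: (ltnP x k) => xk; last first.
      have h C : young C -> (forall x, ymem C x x = (x < k)%N) -> ymem C x y = false.
        move=> yC dC; apply/negbTE/negP => m; have : ymem C x x by exact: youngP yC m _ _.
        by rewrite dC ltnNge xk.
      by rewrite !h.
    case: (ltnP y k) => yk.
      have h C : young C -> (forall x, ymem C x x = (x < k)%N) -> ymem C x y.
        by move=> yC dC; have m : ymem C y y by [rewrite dC]; exact: youngP yC m _ _.
      by rewrite !h.
    have := upE A x (y - k)%N; rewrite e upE subnK // xk /=.
    by [].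
  apply: ymem_inj => x y; case: (leqP x y) => [/H//|/ltnW /H h].
  by rewrite selfconj_sym // h selfconj_sym.
case: ifP => [/andP[kj2 dv]|nd]; last first.
  apply: eq_card0 => A; rewrite !inE; apply/negbTE/negP => /and3P[sA dA /eqP e].
  move: nd; rewrite -e (cup A) // leq_addr addKn dvdn_mulr //.
rewrite -(card_in_imset injd); apply: eq_card => B; rewrite inE.
apply/imsetP/and3P => [[A]|[yB cB /eqP eB]].
  rewrite inE => /and3P[sA dA /eqP e] ->; have /andP[yA _] := sA; split.
  - apply/asboolP => x y x' y' hx hy; rewrite !upE => /andP[xk h].
    by rewrite (leq_ltn_trans hx xk); apply: youngP yA h hx _; rewrite leq_add2r.
  - by apply/asboolP => x y; rewrite upE => /andP[].
  - by apply/eqP; rewrite -e (cup A) // addKn mulKn.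
have eB2 : (k ^ 2 + 2 * #|B| = j)%N.
  by rewrite eB mulnC divnK // subnKC.
(* The diagram rebuilt from [B] fits into the square: [y + k < #|B| + k^2 <= j < K]. *)
have topB x y : ymem B x y -> (y + k < K)%N /\ (x < k)%N.
  move=> h; have := young_lty yB h => hy.
  by split; [nia | exact: ycolsP cB h].
pose A := yof (fun x y => [|| (x < k) && (y < k), (k <= y) && ymem B x (y - k)
                             | (k <= x) && ymem B y (x - k)])%N.
have AE x y : ymem A x y = [|| (x < k) && (y < k), (k <= y) && ymem B x (y - k)
                             | (k <= x) && ymem B y (x - k)]%N.
  rewrite ymem_of; case: (boolP [|| _, _ | _]); rewrite ?andbF //.
  case/or3P => [|/andP[hy /topB]|/andP[hy /topB]] h.
  - by rewrite andbT; lia.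
  - by rewrite andbT; lia.
  - by rewrite andbT; lia.
have dA : durfee k A.
  apply/asboolP => x; rewrite AE; case: (ltnP x k) => //= h.
  by apply/negbTE/negP => /orP[]/topB; lia.
have sA : selfconj A.
  apply/andP; split; last first.
    apply/eqP/ymem_inj => x y; rewrite ymem_tr !AE [(y < k)%N && _]andbC.
    by congr orb; rewrite orbC.
  apply/asboolP => x y x' y' hx hy; rewrite !AE.
  case: (boolP ((x' < k) && (y' < k))%N) => //= hk.
  case/or3P => [|/andP[h1 h2]|/andP[h1 h2]]; first by lia.
  - have [h3 h4] := topB _ _ h2; apply/orP; left.
    by have -> /= : (k <= y')%N by [lia]; apply: youngP yB h2 _ _; lia.
  - have [h3 h4] := topB _ _ h2; apply/orP; right.
    by have -> /= : (k <= x')%N by [lia]; apply: youngP yB h2 _ _; lia.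
have e : B = up A.
  apply: ymem_inj => x y; rewrite upE AE addnK leq_addl /=.
  case: (ltnP x k) => /= xk; last by apply/negbTE/negP => /topB; lia.
  by rewrite orbF; case: ltnP => //; case: y => //; lia.
exists A => //; rewrite inE sA dA /= (cup A) // -e; exact/eqP.
Qed.

(** Every self-conjugate diagram has exactly one Durfee side, at most its size, so sorting by this
    side gives the terms of [coef_s_series]. *)
Lemma gfun_selfconj : fps_eqmod K (gfun selfconj (fun A => #|A|)) s_series.
Proof.
move=> j jK; rewrite (coef_s_series (leqnn j)) big_mkord.
have E (k : 'I_j.+1) : (if (k ^ 2 <= j)%N && (2 %| j - k ^ 2)%N
    then fps_coef (part_series 1 k) ((j - k ^ 2) %/ 2) else 0) =
    #|[set A : ydiag | [&& selfconj A, durfee k A & #|A| == j]]|%:R :> rat.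
  have kj : (k <= j)%N := leq_ord k; rewrite card_durfee //; case: ifP => // _.
  by rewrite coef_ycount //; [lia|apply: leq_ltn_trans (leq_div _ _) _; lia].
rewrite (eq_bigr _ (fun k _ => E k)) -natr_sum; congr _%:R; rewrite -sum1_card.
under [RHS]eq_bigr do rewrite -sum1_card.
rewrite (exchange_big_dep [pred A : ydiag | selfconj A && (#|A| == j)]) /=; last first.
  by move=> k A _; rewrite !inE => /and3P[-> _ ->].
apply: eq_bigr => A /andP[sA /eqP e]; have /andP[yA _] := sA.
have [k dk] := ex_durfee yA; have kj : (k < j.+1)%N by rewrite -e ltnS durfee_le.
rewrite (big_pred1 (Ordinal kj)) // => k'; rewrite !inE sA e eqxx andbT /=.
by apply/idP/eqP => [d|->//]; apply/val_inj/(durfee_uniq d dk).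
Qed.

End YoungDiagrams.

(** * Quadruples of Young diagrams and the symmetries of a rectangle *)

(* (a, b, d) stands for the reflection of the first coordinate if a and of the
   second one if b, followed by the exchange of the coordinates if d. *)
Definition d4 : Type := (bool * bool * bool)%type.
HB.instance Definition _ := Finite.on d4.

Definition d4_one : d4 := (false, false, false).
(** The factor [g] acts first, as for right actions. If it exchanges the coordinates, the
    reflections of [h] concern the opposite original coordinates. *)
Definition d4_mul (g h : d4) : d4 :=
  let: (a, b, d) := g in let: (a', b', d') := h in
  (a (+) (if d then b' else a'), b (+) (if d then a' else b'), d (+) d').
Definition d4_inv (g : d4) : d4 :=
  let: (a, b, d) := g in if d then (b, a, d) else (a, b, d).

Lemma d4_mulA : associative d4_mul.
Proof. by move=> [[[] []] []] [[[] []] []] [[[] []] []]. Qed.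
Lemma d4_mul1 : left_id d4_one d4_mul.
Proof. by move=> [[[] []] []]. Qed.
Lemma d4_mulV : left_inverse d4_one d4_inv d4_mul.
Proof. by move=> [[[] []] []]. Qed.

HB.instance Definition _ := Finite_isGroup.Build d4 d4_mulA d4_mul1 d4_mulV.

Lemma sum_d4 (R : nmodType) (F : d4 -> R) :
  \sum_g F g = \sum_(a : bool) \sum_(b : bool) \sum_(d : bool) F (a, b, d).
Proof.
rewrite pair_bigA /= pair_bigA /=.
by apply: eq_big => // -[[a b] d].
Qed.

(** The symmetry group of a box, where [sq] tells whether the box is a square. *)
Definition d4_box (sq : bool) : {set d4} := [set g : d4 | g.2 ==> sq].

Lemma d4_box_group_set sq : group_set (d4_box sq).
Proof.
apply/group_setP; split; first by rewrite inE.
by move=> [[a b] d] [[a' b'] d']; rewrite !inE /=; case: d d' sq => [] [] [].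
Qed.
Canonical d4_box_group sq := Group (d4_box_group_set sq).

Lemma card_d4_box sq : #|d4_box sq| = (if sq then 8 else 4)%N.
Proof.
rewrite -sum1_card big_mkcond (sum_d4 (R := nat)) !big_bool /=.
by case: sq; rewrite !inE.
Qed.

Lemma sum_d4_box (R : comNzRingType) sq (F : d4 -> R) :
  \sum_(g in d4_box sq) F g =
  F (false, false, false) + F (true, false, false) + F (false, true, false)
  + F (true, true, false) +
  (if sq then F (false, false, true) + F (true, true, true)
     + F (true, false, true) + F (false, true, true) else 0).
Proof.
rewrite big_mkcond sum_d4 !big_bool /= !inE /=.
by case: sq => /=; ring.
Qed.

(** * The action on quadruples of diagrams and its orbits *)

Definition ysize K (A : ydiag K) : nat := #|A|.

Lemma ysize_tr K (A : ydiag K) : ysize (ytr A) = ysize A.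
Proof. exact: card_ytr. Qed.

Section Quadruples.
Variable K : nat.
Local Notation Y := (ydiag K).
Definition quad := ((Y * Y) * (Y * Y))%type.
Implicit Types q : quad.

(* The diagram cut from the corner where the first coordinate is maximal iff a
   and the second one iff b, with that corner as origin. *)
Definition corner q (a b : bool) : Y :=
  let p := if a then q.2 else q.1 in if b then p.2 else p.1.
Definition mkquad (F : bool -> bool -> Y) : quad :=
  ((F false false, F false true), (F true false, F true true)).

Lemma corner_mkquad F a b : corner (mkquad F) a b = F a b.
Proof. by case: a b => [] []. Qed.

Lemma quad_ext q q' : corner q =2 corner q' -> q = q'.
Proof.
move: q q' => [[A B] [C D]] [[A' B'] [C' D']] e.
by move: (e false false) (e false true) (e true false) (e true true) => /= -> -> -> ->.
Qed.

(** The corner [(a', b')] of the image is traced back through the exchange and then the reflections.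
    Each diagram is drawn from its own corner, so reflections only permute the diagrams and the
    exchange alone transposes them. *)
Definition quad_act q (g : d4) : quad :=
  let: (a, b, d) := g in
  mkquad (fun a' b' => if d then ytr (corner q (b' (+) a) (a' (+) b))
                       else corner q (a' (+) a) (b' (+) b)).

Lemma quad_act1 : quad_act^~ 1%g =1 id.
Proof. by move=> [[A B] [C D]]. Qed.

Lemma quad_actM q : act_morph quad_act q.
Proof.
by case: q => [[A B] [C D]] [[[] []] []] [[[] []] []];
  rewrite /quad_act /mkquad /= ?ytrK.
Qed.

Definition qaction : {action d4 &-> quad} := TotalAction quad_act1 quad_actM.

Definition qyoung q := [&& young q.1.1, young q.1.2, young q.2.1 & young q.2.2].
Definition qsize q : nat := (ysize q.1.1 + ysize q.1.2 + (ysize q.2.1 + ysize q.2.2))%N.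
Definition qset k : {set quad} := [set q | qyoung q && (qsize q == k)].

Lemma qyoungP q : reflect (forall a b, young (corner q a b)) (qyoung q).
Proof.
apply: (iffP and4P) => [[h1 h2 h3 h4] [] []//|h].
by split; [apply: (h false false) | apply: (h false true) |
  apply: (h true false) | apply: (h true true)].
Qed.

Lemma qsizeE q : qsize q = (\sum_(a : bool) \sum_(b : bool) ysize (corner q a b))%N.
Proof. by rewrite !big_bool /qsize /corner /=; lia. Qed.

Lemma qyoung_act q g : qyoung (quad_act q g) = qyoung q.
Proof.
case: q g => [[A B] [C D]] [[[] []] []]; rewrite /qyoung /= ?young_tr;
by case: (young A); case: (young B); case: (young C); case: (young D).
Qed.

Lemma qsize_act q g : qsize (quad_act q g) = qsize q.
Proof.
case: q g => [[A B] [C D]] [[[] []] []]; rewrite /qsize /= ?ysize_tr; lia.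
Qed.

Lemma quad_act_qset q g k : (quad_act q g \in qset k) = (q \in qset k).
Proof. by rewrite !inE qyoung_act qsize_act. Qed.

Lemma qset_acts sq k : [acts d4_box sq, on qset k | qaction].
Proof.
apply/subsetP => g _; rewrite !inE /=; apply/subsetP => q qk.
by rewrite inE /= quad_act_qset.
Qed.

Definition qorbits sq k : nat := #|orbit qaction (d4_box sq) @: qset k|.

Definition qfix (g : d4) : fps :=
  gfun (fun q => qyoung q && (quad_act q g == q)) qsize.

Lemma coef_qfix g k : fps_coef (qfix g) k = #|('Fix_(qset k | qaction)[g])%g|%:R.
Proof.
congr _%:R; apply: eq_card => q; rewrite !inE sub1set inE /=.
by rewrite -andbA [(_ == q) && _]andbC andbA.
Qed.

(** Burnside's lemma, with the order of the group moved to the left. *)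
Lemma qorbits_sum sq k :
  ((qorbits sq k)%:R * (if sq then 8 else 4))%R =
  \sum_(g in d4_box sq) fps_coef (qfix g) k :> rat.
Proof.
rewrite -[if sq then _ else _](_ : #|d4_box sq|%:R = _); last first.
  by rewrite card_d4_box; case: sq.
rewrite -natrM -(Frobenius_Cauchy (qset_acts sq k)) natr_sum.
by apply: eq_bigr => g _; rewrite coef_qfix.
Qed.

(** * Quadruples fixed by each symmetry *)

Local Notation a := (gfun (@young K) (@ysize K)).
Local Notation sc := (gfun (@selfconj K) (@ysize K)).

Lemma qfix_id : qfix (false, false, false) = a ^+ 4.
Proof.
rewrite -[4%N]/(2 * 2)%N exprM [a ^+ 2]expr2 expr2 !gfunM.
apply: (gfun_bij (f := id) (g := id)) => -[[A B] [C D]] /=.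
  by case/andP => /and4P[/= -> -> -> ->].
by rewrite /qyoung /= eqxx andbT => /andP[/andP[-> ->] /andP[-> ->]].
Qed.

(** The corners form two pairs with equal diagrams, so one diagram per pair is free; the other axis
    reflection and the half turn only pair the corners differently. *)
Lemma qfix_axis_l : qfix (true, false, false) = fps_subst_Xn 2 a ^+ 2.
Proof.
rewrite expr2 -gfun_dilate // gfunM.
apply: (gfun_bij (f := fun q => q.1) (g := fun p => (p, p))).
  move=> [[A B] [C D]] /= /andP[/and4P[/= -> -> _ _] /eqP[<- <- _ _]].
  by split=> //; rewrite /qsize /=; lia.
by move=> [A B] /= /andP[yA yB]; rewrite /qyoung /= yA yB eqxx.
Qed.

Lemma qfix_axis_r : qfix (false, true, false) = fps_subst_Xn 2 a ^+ 2.
Proof.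
rewrite expr2 -gfun_dilate // gfunM.
apply: (gfun_bij (f := fun q => (q.1.1, q.2.1))
                 (g := fun p => ((p.1, p.1), (p.2, p.2)))).
  move=> [[A B] [C D]] /= /andP[/and4P[/= -> _ -> _] /eqP[<- _ <- _]].
  by split=> //; rewrite /qsize /=; lia.
by move=> [A B] /= /andP[yA yB]; rewrite /qyoung /= yA yB eqxx.
Qed.

Lemma qfix_half_turn : qfix (true, true, false) = fps_subst_Xn 2 a ^+ 2.
Proof.
rewrite expr2 -gfun_dilate // gfunM.
apply: (gfun_bij (f := fun q => q.1)
                 (g := fun p => ((p.1, p.2), (p.2, p.1)))).
  move=> [[A B] [C D]] /= /andP[/and4P[/= -> -> _ _] /eqP[<- <- _ _]].
  by split=> //; rewrite /qsize /=; lia.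
by move=> [A B] /= /andP[yA yB]; rewrite /qyoung /= yA yB eqxx.
Qed.

(** The two corners on the axis carry self-conjugate diagrams, while the other two carry transposes
    of each other. *)
Lemma qfix_diag_l :
  qfix (false, false, true) = sc ^+ 2 * fps_subst_Xn 2 a.
Proof.
rewrite expr2 -gfun_dilate // !gfunM.
apply: (gfun_bij (f := fun q => ((q.1.1, q.2.2), q.1.2))
                 (g := fun p => ((p.1.1, p.2), (ytr p.2, p.1.2)))).
  move=> [[A B] [C D]] /= /andP[/and4P[/= yA yB _ yD] /eqP[eA eB eC eD]].
  rewrite /selfconj yA yB yD. rewrite eA eD !eqxx eC; split=> //.
  by rewrite /qsize /= -eC ysize_tr; lia.
move=> [[A B] C] /= /andP[/andP[/andP[yA /eqP eA] /andP[yB /eqP eB]] yC].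
by rewrite /qyoung /quad_act /mkquad /corner /= young_tr yA yB yC eA eB ytrK eqxx.
Qed.

Lemma qfix_diag_r :
  qfix (true, true, true) = sc ^+ 2 * fps_subst_Xn 2 a.
Proof.
rewrite expr2 -gfun_dilate // !gfunM.
apply: (gfun_bij (f := fun q => ((q.1.2, q.2.1), q.1.1))
                 (g := fun p => ((p.2, p.1.1), (p.1.2, ytr p.2)))).
  move=> [[A B] [C D]] /= /andP[/and4P[/= yA yB yC _] /eqP[eA eB eC eD]].
  rewrite /selfconj yA yB yC eB eC !eqxx eD; split=> //.
  by rewrite /qsize /= -eD ysize_tr; lia.
move=> [[A B] C] /= /andP[/andP[/andP[yA /eqP eA] /andP[yB /eqP eB]] yC].
by rewrite /qyoung /quad_act /mkquad /corner /= young_tr yA yB yC eA eB ytrK eqxx.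
Qed.

(** A quarter turn moves all four corners in one cycle and transposes at every step, so the diagrams
    alternate between [A] and [ytr A] around the box. *)
Lemma qfix_turn_l : qfix (true, false, true) = fps_subst_Xn 4 a.
Proof.
rewrite -gfun_dilate //.
apply: (gfun_bij (f := fun q => q.1.1)
                 (g := fun A => ((A, ytr A), (ytr A, A)))).
  move=> [[A B] [C D]] /= /andP[/and4P[/= yA _ _ _] /eqP[eA eB eC eD]].
  have e1 : C = ytr A by rewrite -eA ytrK.
  have e2 : D = A by rewrite -[D]ytrK eC.
  by rewrite e2 -eB e1; split=> //; rewrite /qsize /= !ysize_tr; lia.
by move=> A /= yA; rewrite /qyoung /quad_act /mkquad /corner /= young_tr yA !ytrK eqxx.
Qed.

Lemma qfix_turn_r : qfix (false, true, true) = fps_subst_Xn 4 a.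
Proof.
rewrite -gfun_dilate //.
apply: (gfun_bij (f := fun q => q.1.1)
                 (g := fun A => ((A, ytr A), (ytr A, A)))).
  move=> [[A B] [C D]] /= /andP[/and4P[/= yA _ _ _] /eqP[eA eB eC eD]].
  have e1 : B = ytr A by rewrite -eA ytrK.
  have e2 : D = A by rewrite -[D]ytrK eB.
  by rewrite e2 -eC e1; split=> //; rewrite /qsize /= !ysize_tr; lia.
by move=> A /= yA; rewrite /qyoung /quad_act /mkquad /corner /= young_tr yA !ytrK eqxx.
Qed.

(** The three nontrivial symmetries of a proper rectangle contribute the same series, whence the
    coefficient 3; the 4 is the order of the group. *)
Lemma qorbits_false k : (k < K)%N ->
  (qorbits false k)%:R = fps_coef r_series k.
Proof.
move=> kK; rewrite /r_series (fps_coef_natdiv _ _ (m := 4)) //.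
apply: (mulIf (x := 4)) => //; rewrite divfK // (qorbits_sum false).
have -> : \sum_(g in d4_box false) fps_coef (qfix g) k =
    fps_coef (a ^+ 4 + 3%:R * fps_subst_Xn 2 a ^+ 2) k.
  rewrite -fps_coef_sum sum_d4_box qfix_id qfix_axis_l qfix_axis_r.
  by rewrite qfix_half_turn; congr fps_coef; ring.
have ea := @gfun_young K.
apply: fps_eqmodD kK; first by rewrite !exprS; do !apply: fps_eqmodM.
by apply: fps_eqmodM => //; rewrite !expr2; apply: fps_eqmodM;
  apply: fps_eqmod_subst.
Qed.

(** Two diagonal reflections and two quarter turns join the symmetries of a rectangle, whence the
    two coefficients 2. *)
Lemma qorbits_true k : (k < K)%N ->
  (qorbits true k)%:R = fps_coef q_series k.
Proof.
move=> kK; rewrite /q_series (fps_coef_natdiv _ _ (m := 8)) //.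
apply: (mulIf (x := 8)) => //; rewrite divfK // (qorbits_sum true).
have -> : \sum_(g in d4_box true) fps_coef (qfix g) k =
    fps_coef (a ^+ 4 + 3%:R * fps_subst_Xn 2 a ^+ 2
              + 2%:R * (sc ^+ 2 * fps_subst_Xn 2 a)
              + 2%:R * fps_subst_Xn 4 a) k.
  rewrite -fps_coef_sum sum_d4_box qfix_id qfix_axis_l qfix_axis_r.
  rewrite qfix_half_turn qfix_diag_l qfix_diag_r qfix_turn_l qfix_turn_r.
  by congr fps_coef; ring.
have ea := @gfun_young K; have es := @gfun_selfconj K.
have e2 := fps_eqmod_subst (isT : (0 < 2)%N) ea.
have e4 := fps_eqmod_subst (isT : (0 < 4)%N) ea.
apply: fps_eqmodD kK; last by apply: fps_eqmodM.
apply: fps_eqmodD; last first.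
  by apply: fps_eqmodM => //; apply: fps_eqmodM => //; rewrite !expr2; apply: fps_eqmodM.
apply: fps_eqmodD; first by rewrite !exprS; do !apply: fps_eqmodM.
by apply: fps_eqmodM => //; rewrite !expr2; apply: fps_eqmodM.
Qed.

End Quadruples.

(** * Perimeter and convexity *)

Implicit Types P Q : {fset cell}.

Definition swap (c : cell) : cell := (c.2, c.1).

Lemma swapK : involutive swap.
Proof. by case. Qed.

Definition fswap P : {fset cell} := [fset swap c | c in P]%fset.

Lemma in_fswap P c : (c \in fswap P) = (swap c \in P).
Proof.
apply/imfsetP/idP => [[d dP ->]|h]; first by rewrite swapK.
by exists (swap c); rewrite ?swapK.
Qed.

Definition cols P : {fset int} := [fset c.1 | c in P]%fset.
Definition rows P : {fset int} := [fset c.2 | c in P]%fset.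

Lemma colsP P x : reflect (exists y, (x, y) \in P) (x \in cols P).
Proof.
apply: (iffP idP) => [/imfsetP[[x' y] h ->]|[y h]]; first by exists y.
by apply/imfsetP; exists (x, y).
Qed.

Lemma rowsP P y : reflect (exists x, (x, y) \in P) (y \in rows P).
Proof.
apply: (iffP idP) => [/imfsetP[[x y'] h ->]|[x h]]; first by exists x.
by apply/imfsetP; exists (x, y).
Qed.

Lemma cols_fswap P : cols (fswap P) = rows P.
Proof.
apply/fsetP => z; apply/colsP/rowsP => -[t h]; exists t; last by rewrite in_fswap.
by rewrite in_fswap in h.
Qed.

Lemma card_le_box P : (#|` P| <= #|` cols P| * #|` rows P|)%N.
Proof.
rewrite -(size_allpairs (fun x y => (x, y))).
apply: uniq_leq_size (fset_uniq _) _ => -[x y] h.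
apply/allpairsP; exists (x, y); split=> //=; first by apply/colsP; exists y.
by apply/rowsP; exists x.
Qed.

Definition col_convex P : Prop := forall x y1 y y2,
  (x, y1) \in P -> (x, y2) \in P -> y1 <= y <= y2 -> (x, y) \in P.
Definition row_convex P : Prop := forall y x1 x x2,
  (x1, y) \in P -> (x2, y) \in P -> x1 <= x <= x2 -> (x, y) \in P.

Lemma col_convex_fswap P : col_convex (fswap P) <-> row_convex P.
Proof.
split=> h y x1 x x2; last by rewrite !in_fswap; exact: h.
by have := h y x1 x x2; rewrite !in_fswap.
Qed.

(** A horizontal boundary edge is represented by the cell above it; vertical ones are obtained by
    applying this to [fswap P]. *)
Definition hbd P : {fset cell} :=
  [fset c in P `|` [fset (c.1, c.2 + 1)%R | c in P]
     | (c \in P) (+) ((c.1, c.2 - 1)%R \in P)]%fset.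

Lemma in_hbd P x y : ((x, y) \in hbd P) = ((x, y) \in P) (+) ((x, y - 1) \in P).
Proof.
rewrite !inE /=; case: (boolP ((x, y) \in P)) => //= _.
case: (boolP ((x, y - 1) \in P)); rewrite ?andbF // => h; rewrite andbT.
by apply/imfsetP; exists (x, y - 1) => //=; rewrite subrK.
Qed.

Lemma in_fset_filter (T : choiceType) (A : {fset T}) (p : pred T) x :
  (x \in [fset c in A | p c]%fset) = (x \in A) && p x.
Proof. by rewrite !inE. Qed.

Lemma card_fset_pair (T : choiceType) (A : {fset T}) (u v : T) : u != v ->
  #|` [fset c in A | (c == u) || (c == v)]|%fset = ((u \in A) + (v \in A))%N.
Proof.
move=> uv; transitivity (size [seq c <- A | (c == u) || (c == v)]).
  apply/perm_size/uniq_perm; rewrite ?filter_uniq ?fset_uniq // => c.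
  by rewrite mem_filter !inE andbC.
rewrite size_filter -!(count_uniq_mem _ (fset_uniq A)) -count_predUI.
rewrite [X in (_ + X)%N](_ : _ = 0%N) ?addn0 //.
apply/eqP; rewrite -leqn0 leqNgt -has_count; apply/negP => /hasP[c _ /andP[]] /=.
by move=> /eqP -> /eqP e; rewrite e eqxx in uv.
Qed.

Lemma in_cell_edges x y b c : ((x, y, b) \in cell_edges c) =
  if b then (c == (x, y)) || (c == (x, y - 1))
  else (c == (x, y)) || (c == (x - 1, y)).
Proof.
case: c => u v; rewrite !inE /= !xpair_eqE /=; case: b; lia.
Qed.

(** An edge belongs to just two cells of the grid, so it belongs to exactly one cell of [P] when the
    exclusive or of their memberships holds. *)
Lemma perimeterE P : perimeter P = (#|` hbd P| + #|` hbd (fswap P)|)%N.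
Proof.
have inE' x y b : ((x, y, b) \in [fset e in \bigcup_(c <- P) cell_edges c
       | #|` [fset c in P | e \in cell_edges c]| == 1%N]%fset) =
    if b then ((x, y) \in P) (+) ((x, y - 1) \in P)
    else ((x, y) \in P) (+) ((x - 1, y) \in P).
  set N := #|` [fset c in P | (x, y, b) \in cell_edges c]|%fset.
  have -> : (if b then ((x, y) \in P) (+) ((x, y - 1) \in P)
    else ((x, y) \in P) (+) ((x - 1, y) \in P)) = (N == 1%N).
    have -> : N = (((x, y) \in P) +
        ((if b then (x, y - 1)%R else (x - 1, y)%R) \in P))%N.
      rewrite /N -card_fset_pair; last by case: b {N}; rewrite xpair_eqE; lia.
      congr #|` _|%fset; apply/fsetP => c.
      rewrite !in_fset_filter in_cell_edges.
      by case: b {N}.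
    by case: b {N}; do 2 case: (_ \in P).
  rewrite in_fset_filter -/N; case: eqP => N1; rewrite ?andbF // andbT.
  have : [fset c in P | (x, y, b) \in cell_edges c]%fset != fset0.
    by rewrite -cardfs_gt0 -/N N1.
  case/fset0Pn => c; rewrite in_fset_filter => /andP[cP ce].
  by apply/bigfcupP; exists c; rewrite ?cP.
rewrite /perimeter; set E := [fset e in _ | _]%fset in inE' *.
have -> : E = ([fset (c.1, c.2, true) | c in hbd P] `|`
               [fset (c.2, c.1, false) | c in hbd (fswap P)])%fset.
  apply/fsetP => -[[x y] b]; rewrite inE' in_fsetU; apply/idP/orP.
    case: b => h; [left | right]; apply/imfsetP.
      by exists (x, y); rewrite //= in_hbd.
    by exists (y, x); rewrite //= in_hbd !in_fswap.
  case=> /imfsetP[[u v] /= h [-> -> ->]]; move: h; rewrite in_hbd //.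
  by rewrite !in_fswap.
rewrite cardfsU (_ : _ `&` _ = fset0)%fset ?cardfs0 ?subn0; last first.
  apply/fsetP => e; rewrite in_fsetI in_fset0; apply/negbTE/negP.
  by case/andP => /imfsetP[c _ ->] /imfsetP[d _ []].
by congr (_ + _)%N; apply: card_imfset => -[x y] [x' y'] /= [-> ->].
Qed.

Lemma seq_int_min (s : seq int) : s != [::] ->
  exists2 m, m \in s & forall z, z \in s -> m <= z.
Proof.
elim: s => // a [|b s] IHs _.
  by exists a; rewrite ?inE // => z; rewrite inE => /eqP ->.
have [//|m ms hm] := IHs; have [am|ma] := leP a m.
  exists a; first by rewrite inE eqxx.
  by move=> z; rewrite inE => /orP[/eqP ->//|/hm]; exact: le_trans.
exists m; first by rewrite inE ms orbT.
by move=> z; rewrite inE => /orP[/eqP ->|/hm//]; exact: ltW.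
Qed.

Lemma seq_int_max (s : seq int) : s != [::] ->
  exists2 m, m \in s & forall z, z \in s -> z <= m.
Proof.
move=> s0; have [|m /mapP[t ts ->] h] := @seq_int_min (map -%R s).
  by case: s s0.
by exists t => // z /(map_f -%R) /h; rewrite lerN2.
Qed.

Lemma column_bounds P : exists bt : int -> int * int, forall x, x \in cols P ->
  [/\ (x, (bt x).1) \in P, (x, (bt x).2) \in P
    & forall y, (x, y) \in P -> (bt x).1 <= y <= (bt x).2].
Proof.
have /choice[bt h] : forall x, exists bt : int * int, x \in cols P ->
    [/\ (x, bt.1) \in P, (x, bt.2) \in P
      & forall y, (x, y) \in P -> bt.1 <= y <= bt.2].
  move=> x; have [/colsP[y0 h0]|] := boolP (x \in cols P); last by exists (0, 0).
  pose s := [seq c.2 | c <- P & c.1 == x].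
  have sE y : (y \in s) = ((x, y) \in P).
    apply/mapP/idP => [[[x' y'] + ->]|h].
      by rewrite mem_filter /= => /andP[/eqP ->].
    by exists (x, y); rewrite // mem_filter eqxx.
  have s0 : s != [::] by apply/eqP => e; move: h0; rewrite -sE e.
  have [b bs hb] := seq_int_min s0; have [t ts ht] := seq_int_max s0.
  exists (b, t) => _; rewrite -!sE; split=> // y; rewrite -sE => ys.
  by rewrite hb // ht.
by exists bt.
Qed.

Section ColumnBoundary.
Variables (P : {fset cell}) (bt : int -> int * int).
Hypothesis btP : forall x, x \in cols P ->
  [/\ (x, (bt x).1) \in P, (x, (bt x).2) \in P
    & forall y, (x, y) \in P -> (bt x).1 <= y <= (bt x).2].

(** The two boundary edges that each nonempty column must have: below its lowest cell and above its
    highest one. *)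
Let B : {fset cell} :=
  ([fset (x, (bt x).1) | x in cols P] `|`
   [fset (x, (bt x).2 + 1)%R | x in cols P])%fset.

Let BP x y : reflect (x \in cols P /\ (y = (bt x).1 \/ y = (bt x).2 + 1))
  ((x, y) \in B).
Proof.
apply: (iffP idP) => [|[xP h]]; rewrite in_fsetU.
  by case/orP => /imfsetP[x' h [-> ->]]; split=> //; [left|right].
by apply/orP; case: h => ->; [left|right]; apply/imfsetP; exists x.
Qed.

Let card_B : #|` B| = (2 * #|` cols P|)%N.
Proof.
rewrite cardfsU (_ : _ `&` _ = fset0)%fset ?cardfs0 ?subn0.
  rewrite mul2n -addnn.
  by congr (_ + _)%N; apply: card_imfset => x x' [].
apply/fsetP => e; rewrite in_fsetI in_fset0; apply/negbTE/negP.
case/andP => /imfsetP[x xP ->] /imfsetP[x' _ [<- e']].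
by have [_ h /(_ _ h)] := btP xP; lia.
Qed.

Let sub_B : (B `<=` hbd P)%fset.
Proof.
apply/fsubsetP => -[x y] /BP[xP e]; rewrite in_hbd.
have [h1 h2 h3] := btP xP; case: e => ->.
  rewrite h1 /=; apply/negP => /h3; lia.
by rewrite addrK h2 addbT; apply/negP => /h3; lia.
Qed.

Lemma hbd_min : (2 * #|` cols P| <= #|` hbd P|)%N.
Proof. by rewrite -card_B; exact: fsubset_leq_card. Qed.

Lemma hbd_eq_convex : #|` hbd P| = (2 * #|` cols P|)%N -> col_convex P.
Proof.
move=> e; have BE : B = hbd P.
  by apply/eqP; rewrite eqEfcard sub_B e card_B leqnn.
move=> x y1 y y2 h1 h2 /andP[le1 le2]; apply: contraT => ny.
have xP : x \in cols P by apply/colsP; exists y1.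
have [_ _ h3] := btP xP.
have [k ek] : exists k : nat, y2 = y + k%:Z by exists `|y2 - y|%N; lia.
(* Between the gap [y] and [y2] some cell of [P] lies above a cell outside [P]. The edge between
   them is above [y1] and not above the top cell, so it is a boundary edge outside [B]. *)
have [j hj nj] : exists2 j : nat, (x, y + j%:Z) \in P & (x, y + j%:Z - 1) \notin P /\ (0 < j)%N.
  rewrite {}ek in h2 {le2}; elim: k h2 => [|k IHk] h2.
    by rewrite addr0 in h2; rewrite h2 in ny.
  have [/IHk//|nk] := boolP ((x, y + k%:Z) \in P).
  by exists k.+1; rewrite // (_ : _ - 1 = y + k%:Z) //; lia.
have : (x, y + j%:Z) \in B by rewrite BE in_hbd hj (negbTE nj.1).
by case/BP => _; have := h3 _ hj; have := h3 _ h1; case: nj; lia.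
Qed.

Lemma convex_hbd_eq : col_convex P -> #|` hbd P| = (2 * #|` cols P|)%N.
Proof.
move=> cP; rewrite -card_B; apply/eqP; rewrite eqn_leq; apply/andP; split; last exact: fsubset_leq_card.
apply: fsubset_leq_card.
apply/fsubsetP => -[x y]; rewrite in_hbd => h.
have xP : x \in cols P.
  by apply/colsP; case: (boolP ((x, y) \in P)) h => [|_ /=]; [exists y|exists (y - 1)].
have [h1 h2 h3] := btP xP; apply/BP; split=> //.
case: (boolP ((x, y) \in P)) h => hy /=.
  move=> /negP nh; left; have := h3 _ hy => hb.
  have [//|ne] := eqVneq y (bt x).1; case: nh; apply: cP h1 hy _; lia.
move=> h; right; have := h3 _ h => hb.
have [//|ne] := eqVneq y ((bt x).2 + 1).
by case/negP: hy; apply: cP h h2 _; lia.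
Qed.

End ColumnBoundary.

Lemma perimeter_min P : (2 * (#|` cols P| + #|` rows P|) <= perimeter P)%N.
Proof.
have [b hb] := column_bounds P; have [b' hb'] := column_bounds (fswap P).
rewrite perimeterE mulnDr leq_add ?(hbd_min hb) // -cols_fswap.
exact: hbd_min hb'.
Qed.

Lemma perimeter_convex P :
  perimeter P = (2 * (#|` cols P| + #|` rows P|))%N <->
  col_convex P /\ row_convex P.
Proof.
have [b hb] := column_bounds P; have [b' hb'] := column_bounds (fswap P).
rewrite perimeterE mulnDr -cols_fswap -(col_convex_fswap P); split.
  have := hbd_min hb; have := hbd_min hb' => h1 h2 e.
  by split; [apply: (hbd_eq_convex hb)|apply: (hbd_eq_convex hb')]; lia.
by case=> h1 h2; rewrite (convex_hbd_eq hb h1) (convex_hbd_eq hb' h2).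
Qed.

(** * Connectedness *)

Lemma share_edge_step c d : share_edge c d ->
  d.1 <= c.1 + 1 /\ d.2 <= c.2 + 1.
Proof.
case/andP => _ /fset0Pn[[[x y] b]]; rewrite in_fsetI !in_cell_edges.
case: c d => [c1 c2] [d1 d2]; rewrite !xpair_eqE /=.
by case: b; lia.
Qed.

Lemma share_edgeP c d : 
  (c.1 == d.1) && ((c.2 == d.2 + 1) || (d.2 == c.2 + 1)) ||
  (c.2 == d.2) && ((c.1 == d.1 + 1) || (d.1 == c.1 + 1)) -> share_edge c d.
Proof.
case: c d => [c1 c2] [d1 d2] /= h; apply/andP; split.
  by rewrite xpair_eqE; lia.
apply/fset0Pn.
have [e|ne] := eqVneq c1 d1.
  exists (c1, Num.max c2 d2, true).
  by rewrite in_fsetI !in_cell_edges !xpair_eqE; lia.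
exists (Num.max c1 d1, c2, false).
by rewrite in_fsetI !in_cell_edges !xpair_eqE; lia.
Qed.

(** A discrete intermediate value theorem: [f] climbs by at most 1 per step and cannot jump over
    [z]. *)
Lemma path_ivt (f : cell -> int) c p z :
  (forall c d, share_edge c d -> f d <= f c + 1) ->
  path share_edge c p -> f c <= z <= f (last c p) ->
  exists2 e, e \in c :: p & f e = z.
Proof.
move=> fS; elim: p c => [|d p IHp] c /=.
  by move=> _ h; exists c; rewrite ?inE //; lia.
case/andP => /fS cd pp h; have [e|ne] := eqVneq (f c) z.
  by exists c; rewrite ?inE ?eqxx.
have [|e es <-] := IHp d pp; first by lia.
by exists e => //; rewrite inE es orbT.
Qed.

Definition int_interval (A : {fset int}) : Prop :=
  forall u z v, u \in A -> v \in A -> u <= z <= v -> z \in A.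

Lemma connected_coord (f : cell -> int) n P :
  (forall c d, share_edge c d -> f d <= f c + 1) ->
  polyomino n P -> int_interval [fset f c | c in P]%fset.
Proof.
move=> fS [_ con] u z v /imfsetP[c cP ->] /imfsetP[d dP ->] h.
have [p [pp lp aP]] := con c d cP dP; rewrite -lp in h.
have [e es <-] := path_ivt fS pp h; apply/imfsetP; exists e => //.
by move: es; rewrite inE => /orP[/eqP ->//|]; move/allP: aP; apply.
Qed.

Lemma int_intervalP (A : {fset int}) : int_interval A ->
  exists x0 : int, forall z, (z \in A) = (x0 <= z < x0 + #|` A|%:Z).
Proof.
move=> iA; have [->|] := eqVneq A fset0.
  by exists 0 => z; rewrite in_fset0 cardfs0; lia.
move=> A0; have s0 : enum_fset A != [::].
  by apply: contraNneq A0 => e; apply/eqP/cardfs0_eq; rewrite e.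
have [b bA hb] := seq_int_min s0; have [t tA ht] := seq_int_max s0.
have AE z : (z \in A) = (b <= z <= t).
  by apply/idP/idP => [h|]; [rewrite hb ?ht|exact: iA].
suff cA : #|` A| = absz (t - b + 1).
  by exists b => z; rewrite AE cA; have := hb t tA; lia.
have -> : A = [fset (b + k%:Z)%R | k in iota 0 (absz (t - b + 1)%R)]%fset.
  apply/fsetP => z; rewrite AE; apply/idP/imfsetP => [h|[k /=]].
    by exists `|z - b|%N; rewrite /= ?mem_iota; lia.
  by rewrite mem_iota => h ->; have := hb t tA; lia.
rewrite card_imfset /=; last by move=> k k' /addrI [].
by rewrite undup_id ?iota_uniq // size_iota.
Qed.

(** * Rectangles with cut corners *)

(** Because of the truncated subtraction this is an involution only for [x < w]. *)
Definition refl (w : nat) (a : bool) (x : nat) : nat :=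
  if a then (w.-1 - x)%N else x.

Lemma reflK w a x : (x < w)%N -> refl w a (refl w a x) = x.
Proof. by rewrite /refl; case: a; lia. Qed.

Lemma refl_lt w a x : (x < w)%N -> (refl w a x < w)%N.
Proof. by rewrite /refl; case: a; lia. Qed.

Lemma refl_addb w a b x : (x < w)%N ->
  refl w (a (+) b) x = refl w a (refl w b x).
Proof. by rewrite /refl; case: a b => [] [] /=; lia. Qed.

Lemma sum_refl w a (F : nat -> nat) :
  (\sum_(0 <= x < w) F (refl w a x) = \sum_(0 <= x < w) F x)%N.
Proof.
case: a => //; rewrite [RHS]big_nat_rev /= [LHS]big_nat_cond [RHS]big_nat_cond.
by apply: eq_bigr => x /andP[/andP[_ xw] _]; congr F; rewrite /refl; lia.
Qed.

(** Pigeonhole principle. With [F] marking missing cells, this produces a full column of the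
    polyomino. *)
Lemma empty_column (F : nat -> nat -> bool) w h :
  (\sum_(0 <= x < w) \sum_(0 <= y < h) F x y < w)%N ->
  exists2 x, (x < w)%N & forall y, (y < h)%N -> ~~ F x y.
Proof.
move=> lt; apply: contrapT => H; move: lt; apply/negP; rewrite -leqNgt.
rewrite -[X in (X <= _)%N]subn0 -[X in (X <= _)%N]muln1 -sum_nat_const_nat.
rewrite big_nat_cond [X in (_ <= X)%N]big_nat_cond.
apply: leq_sum => x /andP[/andP[_ xw] _]; rewrite lt0n; apply/negP => /eqP e.
apply: H; exists x => // y yh; apply/negP => Fxy.
move: e; rewrite (bigD1_seq y) ?mem_index_iota ?iota_uniq //= Fxy.
by [].
Qed.

Lemma empty_row (F : nat -> nat -> bool) w h :
  (\sum_(0 <= x < w) \sum_(0 <= y < h) F x y < h)%N ->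
  exists2 y, (y < h)%N & forall x, (x < w)%N -> ~~ F x y.
Proof.
rewrite exchange_big /= => lt.
exact: (@empty_column (fun y x => F x y) h w lt).
Qed.

Definition zcell (w h : nat) (p : 'I_w * 'I_h) : cell :=
  ((p.1 : nat)%:Z, (p.2 : nat)%:Z).

Lemma zcell_inj w h : injective (@zcell w h).
Proof. by move=> [i j] [i' j'] [/val_inj -> /val_inj ->]. Qed.

Lemma card_zcell (F : nat -> nat -> bool) w h :
  (#|` [fset zcell p | p in [pred p : 'I_w * 'I_h | ~~ F p.1 p.2]]%fset| +
   \sum_(0 <= x < w) \sum_(0 <= y < h) F x y = w * h)%N.
Proof.
rewrite card_imfset; last exact: zcell_inj.
rewrite /= -cardE -sum1_card big_mkcond /=.
have -> : (\sum_(0 <= x < w) \sum_(0 <= y < h) F x y =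
           \sum_(p : 'I_w * 'I_h) F p.1 p.2)%N.
  rewrite big_mkord (eq_bigr (fun i : 'I_w => \sum_(j < h) F i j)%N).
    by rewrite pair_bigA.
  by move=> i _; rewrite big_mkord.
rewrite -big_split /= (eq_bigr (fun=> 1%N)).
  by rewrite sum1_card card_prod !card_ord.
by move=> p _; rewrite unfold_in /=; case: (F _ _).
Qed.

(** * Boxes with four cut corners *)

Section CutBoxes.
Variable K : nat.
Implicit Types q : quad K.

Section Box.
Variables w h : nat.

Definition cut q x y : bool := [exists p : bool * bool,
  ymem (corner q p.1 p.2) (refl w p.1 x) (refl h p.2 y)].

Lemma cutP q x y :
  reflect (exists a b, ymem (corner q a b) (refl w a x) (refl h b y)) (cut q x y).
Proof.
apply: (iffP existsP) => [[[a b] m]|[a [b m]]]; first by exists a, b.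
by exists (a, b).
Qed.

Definition cutbox q : {fset cell} :=
  [fset zcell p | p in [pred p : 'I_w * 'I_h | ~~ cut q p.1 p.2]]%fset.

Lemma cutboxP q c : reflect (exists x y : nat,
    [/\ c = (x%:Z, y%:Z), (x < w)%N, (y < h)%N & ~~ cut q x y]) (c \in cutbox q).
Proof.
apply: (iffP idP) => [/imfsetP[[i j] /= m ->]|[x [y [-> xw yh m]]]].
  by exists i, j; rewrite !ltn_ord.
by apply/imfsetP; exists (Ordinal xw, Ordinal yh).
Qed.

Lemma in_cutbox q (x y : nat) :
  ((x%:Z, y%:Z) \in cutbox q) = [&& (x < w)%N, (y < h)%N & ~~ cut q x y].
Proof.
apply/cutboxP/and3P => [[x' [y' [[-> ->]]]]|[xw yh m]]; first by [].
by exists x, y.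
Qed.

Lemma card_cutbox q :
  (#|` cutbox q| + \sum_(0 <= x < w) \sum_(0 <= y < h) cut q x y = w * h)%N.
Proof. exact: card_zcell. Qed.

(** Each cut cell is counted in exactly one corner. Only support and disjointness are assumed, so
    that this also serves [cutbox_surj], where the size of the quadruple is still to be found. *)
Lemma sum_cut q :
  (forall a b u v, ymem (corner q a b) u v -> (u < w)%N /\ (v < h)%N) ->
  (forall x y a b a' b', (x < w)%N -> (y < h)%N ->
     ymem (corner q a b) (refl w a x) (refl h b y) ->
     ymem (corner q a' b') (refl w a' x) (refl h b' y) -> (a, b) = (a', b')) ->
  (\sum_(0 <= x < w) \sum_(0 <= y < h) cut q x y = qsize q)%N.
Proof.
move=> supp disj; rewrite qsizeE.
have E a b : ysize (corner q a b) = (\sum_(0 <= x < w) \sum_(0 <= y < h)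
    ymem (corner q a b) (refl w a x) (refl h b y))%N.
  rewrite /ysize (card_ymem_le (supp a b)).
  rewrite -(sum_refl w a (fun u => \sum_(0 <= v < h) ymem (corner q a b) u v)%N).
  apply: eq_bigr => x _.
  by rewrite -(sum_refl h b (fun v => ymem (corner q a b) _ v : nat)).
under [RHS]eq_bigr => a _ do under eq_bigr => b _ do rewrite E.
rewrite pair_bigA /= [RHS]exchange_big /= [LHS]big_nat_cond [RHS]big_nat_cond.
apply: eq_bigr => x /andP[/andP[_ xw] _]; rewrite [RHS]exchange_big /=.
rewrite [LHS]big_nat_cond [RHS]big_nat_cond.
apply: eq_bigr => y /andP[/andP[_ yh] _].
case: (boolP (cut q x y)) => [/cutP[a [b m]]|nc].
  rewrite (bigD1 (a, b)) //= m big1 // => -[a' b'] ne.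
  case: (boolP (ymem _ _ _)) => // m'.
  by rewrite (disj _ _ _ _ _ _ xw yh m' m) eqxx in ne.
rewrite big1 // => -[a b] _; case: (boolP (ymem _ _ _)) => // m.
by case/cutP: nc; exists a, b.
Qed.

Section FromQuad.
Variables (k : nat) (q : quad K).
Hypotheses (kw : (k < w)%N) (kh : (k < h)%N) (qk : q \in qset K k).

Let yq a b : young (corner q a b).
Proof. by move: qk; rewrite inE => /andP[/qyoungP]. Qed.

Let sq : qsize q = k.
Proof. by move: qk; rewrite inE => /andP[_ /eqP]. Qed.

Let corner_lt a b u v : ymem (corner q a b) u v ->
  (u < ysize (corner q a b))%N /\ (v < ysize (corner q a b))%N.
Proof. by move=> m; split; [exact: young_ltx m | exact: young_lty m]. Qed.

Let corner_size a b : (ysize (corner q a b) <= k)%N.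
Proof. by rewrite -sq /qsize /corner; case: a b => [] []; lia. Qed.

Let corner_size2 a b a' b' : (a, b) != (a', b') ->
  (ysize (corner q a b) + ysize (corner q a' b') <= k)%N.
Proof.
by rewrite -sq /qsize /corner; case: a b a' b' => [] [] [] [] //= _; lia.
Qed.

(** Diagrams from opposite ends of a side that met would have more cells together than the side has,
    but they have at most [k]. *)
Lemma sum_cut_qset : (\sum_(0 <= x < w) \sum_(0 <= y < h) cut q x y = k)%N.
Proof.
rewrite -sq; apply: sum_cut => [a b u v /corner_lt|x y a b a' b' xw yh m m'].
  by have := corner_size a b; lia.
apply/eqP/negP => /negP ne; have := corner_size2 ne.
have [h1 h2] := corner_lt m; have [h3 h4] := corner_lt m'.
by move: ne h1 h2 h3 h4; rewrite /refl; case: a b a' b' {m m'} => [] [] [] [] //= _; lia.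
Qed.

Lemma card_cutbox_qset : #|` cutbox q| = (w * h - k)%N.
Proof. by have := card_cutbox q; rewrite sum_cut_qset; lia. Qed.

Lemma cutbox_full_col :
  exists2 xs, (xs < w)%N & forall y, (y < h)%N -> ~~ cut q xs y.
Proof. by apply: empty_column; rewrite sum_cut_qset. Qed.

Lemma cutbox_full_row :
  exists2 ys, (ys < h)%N & forall x, (x < w)%N -> ~~ cut q x ys.
Proof. by apply: empty_row; rewrite sum_cut_qset. Qed.

Lemma cut_mono a b x y x' y' :
  ymem (corner q a b) (refl w a x) (refl h b y) ->
  (refl w a x' <= refl w a x)%N -> (refl h b y' <= refl h b y)%N -> cut q x' y'.
Proof. by move=> m hx hy; apply/cutP; exists a, b; exact: youngP m hx hy. Qed.

(** A cut cell forces the rest of its column towards its corner to be cut, so it is not between two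
    uncut cells. *)
Lemma cutbox_col_convex : col_convex (cutbox q).
Proof.
move=> x y1 y y2 /cutboxP[x' [v1 [[-> ->] xw v1h n1]]] /cutboxP[_ [v2 [[<- ->] _ v2h n2]]].
move=> le; have [v ev] : exists v : nat, y = v%:Z by exists `|y|%N; lia.
rewrite {}ev in le *; rewrite in_cutbox xw /=; apply/andP; split; first by lia.
apply/negP => /cutP[a [b m]]; case: b m => m.
  by case/negP: n2; apply: cut_mono m _ _; rewrite /refl; lia.
by case/negP: n1; apply: cut_mono m _ _; rewrite /refl; lia.
Qed.

Lemma cutbox_row_convex : row_convex (cutbox q).
Proof.
move=> y x1 x x2 /cutboxP[v1 [y' [[-> ->] v1w yh n1]]] /cutboxP[v2 [_ [[-> <-] v2w _ n2]]].
move=> le; have [v ev] : exists v : nat, x = v%:Z by exists `|x|%N; lia.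
rewrite {}ev in le *; rewrite in_cutbox yh /=; apply/andP; split; first by lia.
apply/negP => /cutP[a [b m]]; case: a m => m.
  by case/negP: n2; apply: cut_mono m _ _; rewrite /refl; lia.
by case/negP: n1; apply: cut_mono m _ _; rewrite /refl; lia.
Qed.

Lemma cutbox_cols z : (z \in cols (cutbox q)) = (0 <= z < w%:Z).
Proof.
apply/colsP/idP => [[y /cutboxP[x [y' [[-> _] xw _ _]]]]|hz]; first by lia.
have [ys yh full] := cutbox_full_row; exists ys%:Z.
have -> : z = `|z|%N%:Z by lia.
by rewrite in_cutbox yh full; lia.
Qed.

Lemma cutbox_rows z : (z \in rows (cutbox q)) = (0 <= z < h%:Z).
Proof.
apply/rowsP/idP => [[x /cutboxP[x' [y [[_ ->] _ yh _]]]]|hz]; first by lia.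
have [xs xw full] := cutbox_full_col; exists xs%:Z.
have -> : z = `|z|%N%:Z by lia.
by rewrite in_cutbox xw full; lia.
Qed.

(** This recovers the diagrams from the cut cells: an uncut row and column bound four quadrants, and
    a diagram reaching into a foreign quadrant would have to cross one of them. *)
Lemma ymem_corner xs ys a b u v : (xs < w)%N -> (ys < h)%N ->
  (forall y, (y < h)%N -> ~~ cut q xs y) ->
  (forall x, (x < w)%N -> ~~ cut q x ys) ->
  ymem (corner q a b) u v =
  [&& (u < w)%N, (v < h)%N, (u < refl w a xs)%N, (v < refl h b ys)%N
    & cut q (refl w a u) (refl h b v)].
Proof.
move=> xw yh fc fr; apply/idP/and5P => [m|[uw vh lu lv]].
  have [hu hv] := corner_lt m; have := corner_size a b => sz.
  have uw : (u < w)%N by lia.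
  have vh : (v < h)%N by lia.
  have m' : ymem (corner q a b) (refl w a (refl w a u)) (refl h b (refl h b v)).
    by rewrite !reflK.
  split=> //; last by apply/cutP; exists a, b.
    rewrite ltnNge; apply/negP => le; case/negP: (fc _ (refl_lt b vh)).
    by apply: cut_mono m' _ _; rewrite ?reflK.
  rewrite ltnNge; apply/negP => le; case/negP: (fr _ (refl_lt a uw)).
  by apply: cut_mono m' _ _; rewrite ?reflK.
case/cutP => a' [b' m].
have [ea|na] := eqVneq a a'; last first.
  exfalso; case/negP: (fc _ (refl_lt b vh)); apply: cut_mono m _ _ => //.
  by move: na lu; rewrite /refl; case: a a' => [] [] //=; lia.
have [eb|nb] := eqVneq b b'; last first.
  exfalso; case/negP: (fr _ (refl_lt a uw)); apply: cut_mono m _ _ => //.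
  by move: nb lv; rewrite /refl; case: b b' => [] [] //=; lia.
by move: m; rewrite -ea -eb !reflK.
Qed.

End FromQuad.

Lemma cutbox_inj k : (k < w)%N -> (k < h)%N ->
  {in qset K k &, injective cutbox}.
Proof.
move=> kw kh q q' qk qk' e.
have ecut x y : (x < w)%N -> (y < h)%N -> cut q x y = cut q' x y.
  move=> xw yh; have : ((x%:Z, y%:Z) \in cutbox q) = ((x%:Z, y%:Z) \in cutbox q').
    by rewrite e.
  by rewrite !in_cutbox xw yh /= => /negb_inj.
have [xs xw fc] := cutbox_full_col kw kh qk.
have [ys yh fr] := cutbox_full_row kw kh qk.
apply: quad_ext => a b; apply: ymem_inj => u v.
rewrite (ymem_corner kw kh qk _ _ _ _ xw yh) // (ymem_corner kw kh qk' _ _ _ _ xw yh).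
- case: (ltnP u w) => //= uw; case: (ltnP v h) => //= vh.
  by rewrite ecut // refl_lt.
- by move=> y hy; rewrite -ecut // fc.
- by move=> x hx; rewrite -ecut // fr.
Qed.

(** A full column and a full row split the missing cells into four quadrants, and the formula of
    [ymem_corner] serves to define the diagrams. *)
Lemma cutbox_surj k (P : {fset cell}) : (w <= K)%N -> (h <= K)%N ->
  (k < w)%N -> (k < h)%N -> #|` P| = (w * h - k)%N ->
  (forall z, (z \in cols P) = (0 <= z < w%:Z)) ->
  (forall z, (z \in rows P) = (0 <= z < h%:Z)) ->
  col_convex P -> row_convex P ->
  exists2 q, q \in qset K k & cutbox q = P.
Proof.
move=> wK hK kw kh cP colsE rowsE ccP rcP.
pose F x y := (x%:Z, y%:Z) \notin P.
have inbox c : c \in P -> exists x y : nat, [/\ c = (x%:Z, y%:Z), (x < w)%N & (y < h)%N].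
  case: c => x y h0; have : x \in cols P by apply/colsP; exists y.
  have : y \in rows P by apply/rowsP; exists x.
  rewrite colsE rowsE => hy hx; exists `|x|%N, `|y|%N.
  by split; [congr pair; lia | lia | lia].
have sumF : (\sum_(0 <= x < w) \sum_(0 <= y < h) F x y = k)%N.
  have PE : P = [fset zcell p |
                   p in [pred p : 'I_w * 'I_h | ~~ F p.1 p.2]]%fset.
    apply/fsetP => c; apply/idP/imfsetP => [cp|[p + ->]]; last by rewrite unfold_in /= negbK.
    have [x [y [e xw yh]]] := inbox c cp.
    by exists (Ordinal xw, Ordinal yh); rewrite ?e // unfold_in /= negbK -e.
  by have := card_zcell F w h; rewrite -PE cP; nia.
have [|xs xw fc] := @empty_column F w h; first by rewrite sumF.
have [|ys yh fr] := @empty_row F w h; first by rewrite sumF.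
pose q : quad K := mkquad (fun a b => yof K (fun u v =>
  [&& (u < w)%N, (v < h)%N, (u < refl w a xs)%N, (v < refl h b ys)%N
    & F (refl w a u) (refl h b v)])).
have mq a b u v : ymem (corner q a b) u v =
  [&& (u < w)%N, (v < h)%N, (u < refl w a xs)%N, (v < refl h b ys)%N
    & F (refl w a u) (refl h b v)].
  rewrite corner_mkquad ymem_of; case: (ltnP u w) => uw; last by rewrite !andbF.
  case: (ltnP v h) => vh; last by rewrite !andbF.
  by have -> /= : (u < K)%N by [lia]; have -> : (v < K)%N by lia.
have cutF x y : (x < w)%N -> (y < h)%N -> cut q x y = F x y.
  move=> hx hy; apply/cutP/idP => [[a [b]]|Fxy].
    by rewrite mq !reflK // => /and5P[].
  exists (xs < x)%N, (ys < y)%N; rewrite mq !reflK // Fxy !refl_lt //= andbT.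
  have nx : x != xs by apply: contraTneq Fxy => ->; exact: fc.
  have ny : y != ys by apply: contraTneq Fxy => ->; exact: fr.
  by rewrite /refl; case: (ltnP xs x); case: (ltnP ys y); lia.
have qs : qsize q = k.
  rewrite -sumF -sum_cut; last first.
  - move=> x y a b a' b' hx hy; rewrite !mq => /and5P[_ _ h1 h2 _] /and5P[_ _ h3 h4 _].
    by move: h1 h2 h3 h4; rewrite /refl; case: a b a' b' => [] [] [] [] //= *; exfalso; lia.
  - by move=> a b u v; rewrite mq => /and5P[].
  rewrite [LHS]big_nat_cond [RHS]big_nat_cond.
  apply: eq_bigr => x /andP[/andP[_ hx] _].
  rewrite [LHS]big_nat_cond [RHS]big_nat_cond.
  by apply: eq_bigr => y /andP[/andP[_ hy] _]; rewrite cutF.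
have qy : qyoung q.
  apply/qyoungP => a b; apply/asboolP => u v u' v' hu hv; rewrite !mq.
  case/and5P => uw vh lu lv Fuv; apply/and5P; split; try lia.
  apply: contraT; rewrite negbK => h1; case/negP: Fuv.
  have uw' : (u' < w)%N by lia.
  (* If [(u', v')] were present, column convexity with the full row would give [(u', v)], and row
     convexity with the full column would give the missing cell [(u, v)]. *)
  have h2 : ((refl w a u')%:Z, ys%:Z) \in P by have := fr _ (refl_lt a uw'); rewrite negbK.
  have h3 : (xs%:Z, (refl h b v)%:Z) \in P by have := fc _ (refl_lt b vh); rewrite negbK.
  have h4 : ((refl w a u')%:Z, (refl h b v)%:Z) \in P.
    by case: b lv h1 h3 => lv h1 h3; [apply: ccP h2 h1 _ | apply: ccP h1 h2 _];
      rewrite /refl /= in lv *; lia.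
  by case: a lu h1 h2 h4 => lu h1 h2 h4; [apply: rcP h3 h4 _ | apply: rcP h4 h3 _];
    rewrite /refl /= in lu *; lia.
exists q; first by rewrite inE qy qs eqxx.
apply/fsetP => c; apply/cutboxP/idP => [[x [y [-> hx hy]]]|cp].
  by rewrite cutF // negbK.
have [x [y [e hx hy]]] := inbox c cp; exists x, y; split=> //.
by rewrite cutF // negbK -e.
Qed.

End Box.
End CutBoxes.

Lemma card_int_interval (A : {fset int}) (w : nat) :
  (forall z, (z \in A) = (0 <= z < w%:Z)) -> #|` A| = w.
Proof.
move=> AE; have -> : A = [fset k%:Z | k in iota 0 w]%fset.
  apply/fsetP => z; rewrite AE; apply/idP/imfsetP => [h|[k /=]].
    by exists `|z|%N; rewrite /= ?mem_iota; lia.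
  by rewrite mem_iota => h ->; lia.
rewrite card_imfset /=; last by move=> k k' [].
by rewrite undup_id ?iota_uniq // size_iota.
Qed.

(** * Paths in convex sets *)

Definition linked P c d : Prop := exists p : seq cell,
  [/\ path share_edge c p, last c p = d & all (fun x => x \in P) p].

Lemma linked_trans P c d e : linked P c d -> linked P d e -> linked P c e.
Proof.
move=> [p [pp lp aP]] [r [pr lr aR]]; exists (p ++ r).
by rewrite cat_path last_cat all_cat pp lp pr lr aP aR.
Qed.

Lemma linked_line P (g : nat -> cell) k :
  (forall j, (j <= k)%N -> g j \in P) ->
  (forall j, share_edge (g j) (g j.+1) /\ share_edge (g j.+1) (g j)) ->
  linked P (g 0%N) (g k) /\ linked P (g k) (g 0%N).
Proof.
move=> gP gS; elim: k gP => [|k IHk] gP; first by split; exists [::].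
have [|h1 h2] := IHk; first by move=> j jk; apply: gP; lia.
have [e1 e2] := gS k; split.
  apply: linked_trans h1 _; exists [:: g k.+1]; split=> //=; first by rewrite e1.
  by rewrite gP.
apply: linked_trans h2; exists [:: g k]; split=> //=; first by rewrite e2.
by rewrite gP //; lia.
Qed.

Lemma linked_row P y x1 x2 : row_convex P ->
  (x1, y) \in P -> (x2, y) \in P -> linked P (x1, y) (x2, y).
Proof.
move=> rP; have H u v : u <= v -> (u, y) \in P -> (v, y) \in P ->
    linked P (u, y) (v, y) /\ linked P (v, y) (u, y).
  move=> uv hu hv.
  have [] := @linked_line P (fun j => (u + j%:Z, y)) `|v - u|%N.
  - by move=> j hj; apply: rP hu hv _; lia.
  - by move=> j; split; apply: share_edgeP => /=; lia.
  by rewrite addr0 (_ : u + _ = v) //; lia.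
move=> h1 h2; have [le|lt] := leP x1 x2; first by case: (H _ _ le h1 h2).
by case: (H _ _ (ltW lt) h2 h1).
Qed.

Lemma linked_col P x y1 y2 : col_convex P ->
  (x, y1) \in P -> (x, y2) \in P -> linked P (x, y1) (x, y2).
Proof.
move=> cP; have H u v : u <= v -> (x, u) \in P -> (x, v) \in P ->
    linked P (x, u) (x, v) /\ linked P (x, v) (x, u).
  move=> uv hu hv.
  have [] := @linked_line P (fun j => (x, u + j%:Z)) `|v - u|%N.
  - by move=> j hj; apply: cP hu hv _; lia.
  - by move=> j; split; apply: share_edgeP => /=; lia.
  by rewrite addr0 (_ : u + _ = v) //; lia.
move=> h1 h2; have [le|lt] := leP y1 y2; first by case: (H _ _ le h1 h2).
by case: (H _ _ (ltW lt) h2 h1).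
Qed.

(** The path runs along a row to the column [xs], along this column, and along the other row. *)
Lemma linked_convex P xs : row_convex P -> col_convex P ->
  (forall c, c \in P -> (xs, c.2) \in P) ->
  forall c d, c \in P -> d \in P -> linked P c d.
Proof.
move=> rP cP full [x y] [x' y'] hc hd.
apply: linked_trans (linked_row rP hc (full _ hc)) _.
apply: linked_trans (linked_col cP (full _ hc) (full _ hd)) _.
exact: linked_row rP (full _ hd) hd.
Qed.

Lemma cutbox_polyomino K w h k (q : quad K) : (k < w)%N -> (k < h)%N ->
  q \in qset K k -> polyomino (w * h - k) (cutbox w h q).
Proof.
move=> kw kh qk; split; first exact: card_cutbox_qset.
have [xs xw full] := cutbox_full_col kw kh qk.
apply: (linked_convex (xs := xs%:Z)).
- exact: cutbox_row_convex qk.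
- exact: cutbox_col_convex qk.
by move=> _ /cutboxP[x [y [-> _ yh _]]]; rewrite in_cutbox xw yh full.
Qed.

Lemma cutbox_perimeter K w h k (q : quad K) : (k < w)%N -> (k < h)%N ->
  q \in qset K k -> perimeter (cutbox w h q) = (2 * (w + h))%N.
Proof.
move=> kw kh qk.
have -> : (w + h)%N = (#|` cols (cutbox w h q)| + #|` rows (cutbox w h q)|)%N.
  congr (_ + _)%N; apply/esym/card_int_interval => z.
    exact: cutbox_cols kw kh qk z.
  exact: cutbox_rows kw kh qk z.
apply/perimeter_convex; split; first exact: cutbox_col_convex qk.
exact: cutbox_row_convex qk.
Qed.

(** * Congruence *)

Lemma grid_isometry_ext f g : f =1 g -> grid_isometry f -> grid_isometry g.
Proof. by move=> /funext ->. Qed.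

Lemma grid_isometry_id : grid_isometry (fun c => c).
Proof.
by apply: grid_isometry_ext (Translation 0 0) => -[x y] /=; rewrite !addr0.
Qed.

Lemma grid_isometry_swap : grid_isometry swap.
Proof.
apply: grid_isometry_ext (Composition Reflection Rotation) => -[x y] /=.
by rewrite /swap /=; congr pair; lia.
Qed.

(** The generators do not include the inverse rotation, which is obtained as the cube of the
    rotation. *)
Lemma grid_isometry_inv f : grid_isometry f ->
  exists g, [/\ grid_isometry g, cancel f g & cancel g f].
Proof.
elim=> [u v||| f1 g1 _ [f2 [if2 f12 f21]] _ [g2 [ig2 g12 g21]]].
- exists (fun c => (c.1 - u, c.2 - v)); split; first exact: Translation.
    by move=> [x y] /=; rewrite !addrK.
  by move=> [x y] /=; rewrite !subrK.
- exists (fun c => (c.2, - c.1 - 1)); split.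
  + apply: grid_isometry_ext (Composition Rotation (Composition Rotation Rotation)).
    by move=> [x y] /=; congr pair; lia.
  + by move=> [x y] /=; congr pair; lia.
  + by move=> [x y] /=; congr pair; lia.
- exists (fun c => (- c.1 - 1, c.2)); split; first exact: Reflection.
    by move=> [x y] /=; congr pair; lia.
  by move=> [x y] /=; congr pair; lia.
- exists (fun c => g2 (f2 c)); split; first exact: Composition.
    by move=> c /=; rewrite f12 g12.
  by move=> c /=; rewrite g21 f21.
Qed.

Lemma imfset_compose (f g : cell -> cell) P :
  [fset f c | c in [fset g c | c in P]]%fset = [fset f (g c) | c in P]%fset.
Proof.
apply/fsetP => e; apply/imfsetP/imfsetP => [[d /imfsetP[c cP ->] ->]|[c cP ->]].
  by exists c.
by exists (g c) => //; apply/imfsetP; exists c.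
Qed.

Lemma imfset_idE (f : cell -> cell) P : f =1 id -> [fset f c | c in P]%fset = P.
Proof.
move=> fE; apply/fsetP => e; apply/imfsetP/idP => [[c cP ->]|eP]; first by rewrite fE.
by exists e; rewrite ?fE.
Qed.

Lemma congruent_refl P : congruent P P.
Proof.
by exists (fun c => c); [exact: grid_isometry_id | rewrite imfset_idE].
Qed.

Lemma congruent_sym P Q : congruent P Q -> congruent Q P.
Proof.
case=> f /grid_isometry_inv[g [ig fg _]] ->; exists g => //.
by rewrite imfset_compose imfset_idE.
Qed.

Lemma congruent_trans P Q R : congruent P Q -> congruent Q R -> congruent P R.
Proof.
case=> f fi -> [g gi ->]; exists (fun c => g (f c)); first exact: Composition.
by rewrite imfset_compose.
Qed.

Lemma congruence_class_eq P Q :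
  congruence_class P = congruence_class Q <-> congruent P Q.
Proof.
split=> [e|PQ].
  have : congruence_class Q Q by exact: congruent_refl.
  by rewrite -e.
apply/seteqP; split=> R /= h; last exact: congruent_trans PQ h.
exact: congruent_trans (congruent_sym PQ) h.
Qed.

(** * Symmetries of a box as grid isometries *)

Definition swap_if (d : bool) (c : cell) : cell := if d then swap c else c.

Definition flipz (a : bool) (w z : int) : int := if a then w - z else z.

Definition box_iso (w h : nat) (g : d4) (c : cell) : cell :=
  swap_if g.2 (flipz g.1.1 (w%:Z - 1) c.1, flipz g.1.2 (h%:Z - 1) c.2).

Lemma grid_isometry_linear f : grid_isometry f ->
  exists (g : d4) u v, forall c,
    f c = let e := swap_if g.2 (flipz g.1.1 0 c.1, flipz g.1.2 0 c.2) in
          (e.1 + u, e.2 + v).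
Proof.
elim=> [u v||| f1 f2 _ [g1 [u1 [v1 E1]]] _ [g2 [u2 [v2 E2]]]].
- by exists (false, false, false), u, v.
- by exists (false, true, true), (-1), 0 => -[x y] /=; congr pair; lia.
- by exists (true, false, false), (-1), 0 => -[x y] /=; congr pair; lia.
pose t := swap_if g1.2 (flipz g1.1.1 0 u2, flipz g1.1.2 0 v2).
(* [f2] acts first and [d4_mul] has the first map on its left; [t] is the translation of [f2] moved
   through the linear part of [f1]. *)
exists (d4_mul g2 g1), (t.1 + u1), (t.2 + v1) => -[x y].
rewrite E1 E2 {}/t; case: g1 g2 {E1 E2} => [[a b] d] [[a' b'] d'].
rewrite /swap_if /flipz /swap /=.
by case: a b d a' b' d' => [] [] [] [] [] [] /=; congr pair; ring.
Qed.

(** [box_iso] reflects the cells [0, ..., w - 1] onto themselves, and the constants this adds to the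
    linear part are absorbed in the translation. *)
Lemma grid_isometry_box w h f : grid_isometry f ->
  exists (g : d4) u v, forall c,
    f c = ((box_iso w h g c).1 + u, (box_iso w h g c).2 + v).
Proof.
case/grid_isometry_linear => g [u [v E]].
pose t := swap_if g.2 (if g.1.1 then w%:Z - 1 else 0, if g.1.2 then h%:Z - 1 else 0).
exists g, (u - t.1), (v - t.2) => c; rewrite E {}/t /box_iso.
case: g {E} => [[a b] d]; rewrite /swap_if /flipz /swap /=.
by case: a b d => [] [] [] /=; congr pair; ring.
Qed.

Lemma box_iso_isometry w h g : grid_isometry (box_iso w h g).
Proof.
have fl a t : grid_isometry (fun c => (flipz a t c.1, c.2)).
  case: a; last by apply: grid_isometry_ext grid_isometry_id => -[].
  apply: grid_isometry_ext (Composition (Translation (t + 1) 0) Reflection) => -[x y].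
  by rewrite /flipz /=; congr pair; lia.
have fr a t : grid_isometry (fun c => (c.1, flipz a t c.2)).
  apply: grid_isometry_ext
    (Composition grid_isometry_swap (Composition (fl a t) grid_isometry_swap)) => -[x y].
  by [].
have sw (d : bool) : grid_isometry (swap_if d).
  by case: d; [exact: grid_isometry_swap | exact: grid_isometry_id].
apply: grid_isometry_ext (Composition (sw g.2)
  (Composition (fl g.1.1 (w%:Z - 1)) (fr g.1.2 (h%:Z - 1)))) => -[x y].
by [].
Qed.

Section CutBoxCongruence.
Variable K : nat.
Implicit Types q : quad K.

Lemma cut_quad_act w h q a b (d : bool) x y : (x < w)%N -> (y < h)%N ->
  cut (if d then h else w) (if d then w else h) (quad_act q (a, b, d))
      (if d then y else x) (if d then x else y) =
  cut w h q (refl w a x) (refl h b y).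
Proof.
move=> xw yh; apply/cutP/cutP => -[a' [b']].
  rewrite corner_mkquad; case: d; rewrite ?ymem_tr => m.
    by exists (b' (+) a), (a' (+) b); rewrite !refl_addb ?reflK ?refl_lt.
  by exists (a' (+) a), (b' (+) b); rewrite !refl_addb ?reflK ?refl_lt.
move=> m; exists (if d then b' (+) b else a' (+) a), (if d then a' (+) a else b' (+) b).
by rewrite corner_mkquad; case: d; rewrite ?ymem_tr !addbK !refl_addb.
Qed.

Lemma box_iso_cutbox w h q (g : d4) :
  [fset box_iso w h g c | c in cutbox w h q]%fset =
  cutbox (if g.2 then h else w) (if g.2 then w else h) (quad_act q g).
Proof.
case: g => [[a b] d] /=; apply/fsetP => c; apply/imfsetP/cutboxP.
  case=> _ /cutboxP[x [y [-> xw yh nc]]] ->.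
  have h1 := refl_lt a xw; have h2 := refl_lt b yh.
  exists (if d then refl h b y else refl w a x), (if d then refl w a x else refl h b y).
  rewrite cut_quad_act // !reflK //; split=> //; last 2 first.
  - by case: d.
  - by case: d.
  rewrite /box_iso /swap_if /flipz /swap /refl /=.
  by case: a b d {h1 h2 nc} => [] [] [] /=; congr pair; lia.
case=> x' [y' [-> xw yh nc]].
pose x := if d then y' else x'; pose y := if d then x' else y'.
have hx : (x < w)%N by rewrite /x; case: d xw yh {nc x y}.
have hy : (y < h)%N by rewrite /y; case: d xw yh {nc x y hx}.
have nc' : ~~ cut w h q (refl w a x) (refl h b y).
  by move: nc; rewrite -(cut_quad_act _ _ _ d hx hy) /x /y; case: d {x y hx hy xw yh}.
exists ((refl w a x)%:Z, (refl h b y)%:Z).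
  by rewrite in_cutbox !refl_lt.
rewrite /box_iso /swap_if /flipz /swap /refl /= /x /y.
by case: a b d xw yh {nc nc' x y hx hy} => [] [] [] /= xw yh; congr pair; lia.
Qed.

Lemma translated_interval (u : int) (w w' : nat) : (0 < w)%N ->
  (forall z, (0 <= z - u < w%:Z) = (0 <= z < w'%:Z)) -> u = 0 /\ w = w'.
Proof.
move=> w0 E; have := E u; have := E (u - 1); have := E (u + w%:Z - 1).
by have := E (u + w%:Z); have := E 0; lia.
Qed.

(** Both sets touch all four sides of their boxes, so the translation left after the symmetry
    vanishes and the boxes coincide. With the shorter side first, an exchange of coordinates is
    possible only for a square. *)
Lemma cutbox_congruent w h k q w' h' k' q' :
  (w <= h)%N -> (w' <= h')%N -> (k < w)%N -> (k' < w')%N ->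
  q \in qset K k -> q' \in qset K k' ->
  congruent (cutbox w h q) (cutbox w' h' q') <->
  [/\ w = w', h = h' & q' \in orbit (qaction K) (d4_box (w == h)) q].
Proof.
move=> wh wh' kw kw' qk qk'; have kh : (k < h)%N by lia.
have kh' : (k' < h')%N by lia.
split=> [[f /(grid_isometry_box w h)[g [u [v fE]]] e]|[<- <- /orbitP[g gd <-]]]; last first.
  exists (box_iso w h g); first exact: box_iso_isometry.
  rewrite box_iso_cutbox; move: gd; rewrite inE.
  by case: g.2 => //= /eqP ->.
pose w1 := if g.2 then h else w; pose h1 := if g.2 then w else h.
have qg : quad_act q g \in qset K k by rewrite quad_act_qset.
have kw1 : (k < w1)%N by rewrite /w1; case: ifP.
have kh1 : (k < h1)%N by rewrite /h1; case: ifP.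
have {}e : cutbox w' h' q' = [fset (c.1 + u, c.2 + v)%R | c in cutbox w1 h1 (quad_act q g)]%fset.
  rewrite e -box_iso_cutbox imfset_compose; apply/fsetP => c.
  by apply/imfsetP/imfsetP => -[c' h0 ->]; exists c' => //; rewrite fE.
have mem_e x y : ((x, y) \in cutbox w' h' q') = ((x - u, y - v) \in cutbox w1 h1 (quad_act q g)).
  rewrite e; apply/imfsetP/idP => [[[x' y'] h0 [-> ->]]|h0]; first by rewrite !addrK.
  by exists (x - u, y - v); rewrite //= !subrK.
have [u0 ew] : u = 0 /\ w1 = w'.
  apply: translated_interval => [|z]; first by lia.
  rewrite -(cutbox_cols kw1 kh1 qg) -(cutbox_cols kw' kh' qk').
  apply/colsP/colsP => -[y]; rewrite ?mem_e => h0; first exists (y + v).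
    by rewrite mem_e addrK.
  by exists (y - v).
have [v0 eh] : v = 0 /\ h1 = h'.
  apply: translated_interval => [|z]; first by lia.
  rewrite -(cutbox_rows kw1 kh1 qg) -(cutbox_rows kw' kh' qk').
  apply/rowsP/rowsP => -[x]; rewrite ?mem_e => h0; first exists (x + u).
    by rewrite mem_e addrK.
  by exists (x - u).
have {}e : cutbox w1 h1 q' = cutbox w1 h1 (quad_act q g).
  rewrite [in LHS]ew [in LHS]eh; apply/fsetP => -[x y].
  by rewrite mem_e u0 v0 !subr0.
have wh1 : g.2 -> w = h by move: ew eh; rewrite /w1 /h1; case: g.2; lia.
have w1E : w1 = w by move: wh1; rewrite /w1; case: g.2 => // ->.
have h1E : h1 = h by move: wh1; rewrite /h1; case: g.2 => // ->.
have ek : k = k'.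
  have := card_cutbox_qset kw1 kh1 qg; rewrite -e.
  rewrite [in cutbox _ _]ew [in cutbox _ _]eh (card_cutbox_qset kw' kh' qk') -ew -eh.
  by nia.
rewrite -ek in qk'.
split; [by rewrite -w1E|by rewrite -h1E|].
apply/orbitP; exists g; first by rewrite inE; apply/implyP => /wh1 ->.
by apply: (cutbox_inj kw1 kh1).
Qed.

End CutBoxCongruence.

(** * Counting the classes *)

(** Congruence classes are infinite sets, so they are counted through a finite invariant [psi] with
    the same fibres; [chi] maps the invariant to the class, with [v0] as default value. *)
Lemma card_fset_set_image (T U : finType) (V : choiceType) (v0 : V)
    (S : {set T}) (phi : T -> V) (psi : T -> U) :
  {in S &, forall p p', phi p = phi p' <-> psi p = psi p'} ->
  #|` fset_set [set phi p | p in [set p | p \in S]]%classic|%fset = #|psi @: S|.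
Proof.
move=> E; pose chi u := if [pick p in S | psi p == u] is Some p then phi p else v0.
have chiE p : p \in S -> chi (psi p) = phi p.
  move=> pS; rewrite /chi; case: pickP => [p' /andP[pS' /eqP e]|/(_ p)].
    by apply/(E _ _ pS' pS).
  by rewrite pS eqxx.
have -> : [set phi p | p in [set p | p \in S]]%classic =
    [set` [fset chi u | u in psi @: S]%fset]%classic.
  apply/seteqP; split=> v /=.
    case=> p pS <-; apply/imfsetP; exists (psi p); first exact: imset_f.
    by rewrite chiE.
  by case/imfsetP => u /= /imsetP[p pS ->] ->; exists p; rewrite ?chiE.
rewrite set_fsetK card_in_imfset /= -?cardE // => u u' /imsetP[p pS ->] /imsetP[p' pS' ->].
by rewrite !chiE // => /(E _ _ pS pS').
Qed.

(** A row of [k] cells in one corner; this shows that the minimum perimeter is attained. *)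
Lemma qset_nonempty K k : (k < K)%N -> exists q : quad K, q \in qset K k.
Proof.
move=> kK; pose A := yof K (fun x y => (x < k)%N && (y == 0%N)).
have AE x y : ymem A x y = (x < k)%N && (y == 0%N).
  by rewrite ymem_of; apply/and4P/andP => [[]//|[h /eqP ->]]; split=> //; lia.
have yA : young A.
  by apply/asboolP => x y x' y' hx hy; rewrite !AE; lia.
have sA : ysize A = k.
  rewrite /ysize (@card_ymem_le _ _ k 1); last by move=> x y; rewrite AE; lia.
  rewrite -[RHS]muln1 -[k in RHS]subn0 -sum_nat_const_nat.
  rewrite [LHS]big_nat_cond [RHS]big_nat_cond.
  by apply: eq_bigr => x /andP[/andP[_ xk] _]; rewrite big_nat1 AE xk.
exists ((A, set0), (set0, set0)); rewrite inE /qyoung /qsize /= yA young_set0 sA.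
by rewrite /ysize !cards0 !addn0 eqxx.
Qed.

Lemma in_translate P (u v : int) c :
  (c \in [fset (c.1 + u, c.2 + v)%R | c in P]%fset) = ((c.1 - u, c.2 - v) \in P).
Proof.
case: c => x y; apply/imfsetP/idP => [[[x' y'] h [-> ->]]|h] /=; first by rewrite !addrK.
by exists (x - u, y - v); rewrite //= !subrK.
Qed.

(** With [h = w + t] this is [4 w (h - 1) <= (w + h - 1)^2], the inequality of the means for a box
    with one line of [w] cells removed. *)
Lemma cut_bound w t m : m.+1 = (2 * w + t)%N ->
  (4 * (w * (w + t)) <= 4 * w + m ^ 2)%N.
Proof.
case: t => [|t] e.
  case: w e => [|w] e; first by lia.
  by have -> : m = (2 * w).+1 by [lia]; clear; nia.
by have -> : m = (2 * w + t)%N by [lia]; clear; nia.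
Qed.

(** * Boxes of minimal semiperimeter *)

Section Count.
Variables (n M : nat).
Hypotheses (n_gt0 : (0 < n)%N) (M_low : (M.-1 ^ 2 < 4 * n)%N)
  (M_up : (4 * n <= M ^ 2)%N).

Lemma box_semiperimeter w h : (n <= w * h)%N -> (M <= w + h)%N.
Proof.
move=> nwh; rewrite leqNgt; apply/negP => lt.
have le : (w + h <= M.-1)%N by lia.
have [le4 _] := nat_AGM2 w h.
have := leq_mul le le; rewrite !mulnn; lia.
Qed.

(** Only the shorter side is recorded, so boxes with exchanged sides count once. *)
Definition box_width (w : 'I_M) : bool := (2 * w <= M)%N && (n <= w * (M - w))%N.

Lemma box_width_cut (w : 'I_M) : box_width w -> (w * (M - w) - n < w)%N.
Proof.
case/andP => h1 h2; have wM := ltn_ord w.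
have [h eh] : exists h, M = (w + h)%N by exists (M - w)%N; lia.
have [m em] : exists m, M = m.+1 by exists M.-1; lia.
have e : (M - w = h)%N by lia.
rewrite e in h2 *; have wh : (w <= h)%N by lia.
have [t et] : exists t : nat, h = (w + t)%N by exists (h - w)%N; lia.
have M_low' : (m ^ 2 < 4 * n)%N by rewrite (_ : m = M.-1) //; lia.
have := @cut_bound w t m; rewrite -et => h3.
have w0 : (0 < w)%N by case: (posnP w) h2 => // ->; lia.
have := h3 _; lia.
Qed.

(** The most nearly square box has the largest area, the integer part of [M^2 / 4]. *)
Lemma half_width : exists w : 'I_M, box_width w.
Proof.
have M1 : (1 < M)%N by case: (M) M_up => [|[|?]] //; lia.
have lt : (M %/ 2 < M)%N by rewrite ltn_Pdiv; lia.
exists (Ordinal lt); rewrite /box_width /=.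
set t := (M %/ 2)%N.
have [et|et] : (M = 2 * t \/ M = 2 * t + 1)%N by rewrite /t; lia.
  have -> : (M - t = t)%N by lia.
  by move: M_up; rewrite et mulnn expnMn; lia.
have -> : (M - t = t.+1)%N by lia.
by move: M_up; rewrite et -mulnn; lia.
Qed.

Lemma cutbox_min_candidate (w : 'I_M) (q : quad M) : box_width w ->
  q \in qset M (w * (M - w) - n)%N ->
  polyomino n (cutbox w (M - w)%N q) /\ perimeter (cutbox w (M - w)%N q) = (2 * M)%N.
Proof.
move=> bw qk; have kw := box_width_cut bw; have wM := ltn_ord w.
have /andP[h1 h2] := bw.
have kh : (w * (M - w) - n < M - w)%N by lia.
split.
  by have := cutbox_polyomino kw kh qk; rewrite subKn.
by rewrite (cutbox_perimeter kw kh qk) subnKC // ltnW.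
Qed.

Lemma perimeter_ge P : polyomino n P -> (2 * M <= perimeter P)%N.
Proof.
move=> [cP _]; apply: leq_trans (perimeter_min P); rewrite leq_mul2l /=.
by apply: box_semiperimeter; rewrite -cP; exact: card_le_box.
Qed.

Lemma min_perimeterE : min_perimeter n = (2 * M)%N.
Proof.
have mM : is_min_perimeter n (2 * M)%N.
  split; last by move=> P /perimeter_ge.
  have [w bw] := half_width; have kw := box_width_cut bw.
  have kM : (w * (M - w) - n < M)%N by exact: ltn_trans kw (ltn_ord w).
  have [q qk] := qset_nonempty kM; have [h1 h2] := cutbox_min_candidate bw qk.
  by exists (cutbox w (M - w)%N q).
rewrite /min_perimeter; case: xgetP => [m -> [[P pP eP] lem]|/(_ (2 * M)%N)[]//].
case: mM => -[Q pQ eQ] leM; apply/eqP; rewrite eqn_leq.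
by rewrite -{1}eQ lem // -eP leM.
Qed.

Lemma min_polyomino_cutbox P : min_polyominoes n P ->
  exists2 w : 'I_M, box_width w & exists2 q, q \in qset M (w * (M - w) - n)%N &
    congruent P (cutbox w (M - w)%N q).
Proof.
case=> pP; rewrite min_perimeterE => perP; have [cP _] := pP.
have le1 := perimeter_min P; have le2 := card_le_box P.
have le3 : (M <= #|` cols P| + #|` rows P|)%N.
  by apply: box_semiperimeter; rewrite -cP.
have eM : (#|` cols P| + #|` rows P| = M)%N by lia.
have [cc rc] : col_convex P /\ row_convex P by apply/perimeter_convex; rewrite eM.
have [x0 ex] := int_intervalP (connected_coord (f := fst)
  (fun c d h => (share_edge_step h).1) pP).
have [y0 ey] := int_intervalP (connected_coord (f := snd)
  (fun c d h => (share_edge_step h).2) pP).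
have {}ex z : (z \in cols P) = (x0 <= z < x0 + #|` cols P|%:Z) by exact: ex.
have {}ey z : (z \in rows P) = (y0 <= z < y0 + #|` rows P|%:Z) by exact: ey.
set cw := #|` cols P| in le2 eM ex; set ch := #|` rows P| in le2 eM ey.
have w0 : (0 < cw)%N by nia.
have h0 : (0 < ch)%N by nia.
pose T : {fset cell} := [fset (c.1 - x0, c.2 - y0)%R | c in P]%fset.
have cPT : congruent P T by exists (fun c => (c.1 - x0, c.2 - y0)) => //; exact: Translation.
have TE x y : ((x, y) \in T) = ((x + x0, y + y0) \in P).
  by rewrite in_translate /= !opprK.
have cT : #|` T| = n.
  rewrite -cP; apply/eqP; apply/card_in_imfsetP => -[x y] [x' y'] _ _ [].
  by move=> /addIr -> /addIr ->.
have colT z : (z \in cols T) = (0 <= z < cw%:Z).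
  transitivity (z + x0 \in cols P); last by rewrite ex; lia.
  apply/colsP/colsP => -[y]; rewrite ?TE => h; first by exists (y + y0).
  by exists (y - y0); rewrite TE subrK.
have rowT z : (z \in rows T) = (0 <= z < ch%:Z).
  transitivity (z + y0 \in rows P); last by rewrite ey; lia.
  apply/rowsP/rowsP => -[y]; rewrite ?TE => h; first by exists (y + x0).
  by exists (y - x0); rewrite TE subrK.
have ccT : col_convex T.
  by move=> x y1 y y2; rewrite !TE => h1 h2 h3; apply: cc h1 h2 _; lia.
have rcT : row_convex T.
  by move=> y x1 x x2; rewrite !TE => h1 h2 h3; apply: rc h1 h2 _; lia.
have [ch' cw'] : (ch < M)%N /\ (cw < M)%N by lia.
(* Used for the translate [T] when it is at least as high as wide, and for its mirror image
   otherwise. *)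
have H w h Q : (w <= h)%N -> (w + h = M)%N -> (0 < w)%N -> (n <= w * h)%N ->
    congruent P Q -> #|` Q| = n ->
    (forall z, (z \in cols Q) = (0 <= z < w%:Z)) ->
    (forall z, (z \in rows Q) = (0 <= z < h%:Z)) ->
    col_convex Q -> row_convex Q ->
    exists2 w : 'I_M, box_width w & exists2 q, q \in qset M (w * (M - w) - n)%N &
      congruent P (cutbox w (M - w)%N q).
  move=> wh ewh wp nwh PQ cQ colQ rowQ ccQ rcQ.
  have wM : (w < M)%N by lia.
  have hE : (M - w = h)%N by lia.
  have bw : box_width (Ordinal wM) by rewrite /box_width /= hE nwh; lia.
  exists (Ordinal wM) => //=; have /= kw := box_width_cut bw; rewrite hE in kw *.
  have kh : (w * h - n < h)%N by lia.
  have [|||q qk e] := @cutbox_surj M w h (w * h - n)%N Q _ _ kw kh _ colQ rowQ ccQ rcQ.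
  - by lia.
  - by lia.
  - by rewrite cQ subKn.
  by exists q => //; rewrite e.
have [le|lt] := leqP cw ch.
  by apply: (H cw ch T) => //; rewrite -cP.
apply: (H ch cw (fswap T)) => //.
- exact: ltnW.
- by rewrite addnC.
- by rewrite mulnC -cP.
- apply: congruent_trans cPT _; exists swap => //; exact: grid_isometry_swap.
- rewrite -cT; apply/eqP; apply/card_in_imfsetP => c d _ _.
  exact: (can_inj swapK).
- by rewrite cols_fswap.
- by move=> z; rewrite -cols_fswap (_ : fswap (fswap T) = T) //;
    apply/fsetP => c; rewrite !in_fswap swapK.
- exact/col_convex_fswap.
- apply/col_convex_fswap; rewrite (_ : fswap (fswap T) = T) //.
  by apply/fsetP => c; rewrite !in_fswap swapK.
Qed.

(** The invariant of a class is the width of its box together with an orbit of quadruples. *)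
Theorem num_min_polyominoesE : num_min_polyominoes n =
  (\sum_(w < M | box_width w) qorbits M (w == M - w :> nat) (w * (M - w) - n))%N.
Proof.
pose S : {set 'I_M * quad M} :=
  [set p | box_width p.1 && (p.2 \in qset M (p.1 * (M - p.1) - n)%N)].
have inS w q : ((w, q) \in S) = box_width w && (q \in qset M (w * (M - w) - n)%N).
  by rewrite in_set.
pose phi (p : 'I_M * quad M) := congruence_class (cutbox p.1 (M - p.1)%N p.2).
pose orb (w : 'I_M) := orbit (qaction M) (d4_box (w == M - w :> nat)%N).
pose psi (p : 'I_M * quad M) := (p.1, orb p.1 p.2).
have E : {in S &, forall p p', phi p = phi p' <-> psi p = psi p'}.
  move=> [w q] [w' q']; rewrite !inS => /andP[bw qk] /andP[bw' qk'].
  have kw := box_width_cut bw; have kw' := box_width_cut bw'.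
  have /andP[h1 _] := bw; have /andP[h1' _] := bw'.
  rewrite /phi /= congruence_class_eq.
  have wh : (w <= M - w)%N by lia.
  have wh' : (w' <= M - w')%N by lia.
  have [H1 H2] := cutbox_congruent wh wh' kw kw' qk qk'.
  split=> [/H1[/val_inj ew _ oq]|[ew oq]].
    by rewrite /psi /= -ew; congr pair; apply/esym/orbit_eqP.
  apply: H2; rewrite -ew; split=> //.
  by rewrite -[orbit _ _ _]/(orb w q) oq /orb -ew orbit_refl.
have -> : num_min_polyominoes n = #|psi @: S|.
  rewrite -(card_fset_set_image classical_sets.set0 E); congr #|` fset_set _|%fset.
  apply/seteqP; split=> C /=.
    case=> P /min_polyomino_cutbox[w bw [q qk PQ]] <-; exists (w, q).
      by rewrite /= inS bw qk.
    by apply/esym/congruence_class_eq.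
  case=> -[w q]; rewrite /= inS => /andP[bw qk] <-.
  exists (cutbox w (M - w)%N q) => //; have [h1 h2] := cutbox_min_candidate bw qk.
  by split=> //; rewrite min_perimeterE.
rewrite -sum1_card (partition_big fst box_width) /=; last first.
  by move=> u /imsetP[[w q]]; rewrite inS => /andP[bw _] ->.
apply: eq_bigr => w bw; rewrite /qorbits -/(orb w) sum1dep_card.
have inj : injective (fun o : {set quad M} => (w, o)) by move=> o o' [].
rewrite -(card_imset _ inj); apply: eq_card => -[w' o]; rewrite inE.
apply/andP/imsetP => [[/imsetP[[w1 q]]]|[_ /imsetP[q qk ->] [-> ->]]].
  rewrite inS => /andP[_ qk] [-> ->] /eqP <-.
  by exists (orb w1 q) => //; exact: imset_f.
by split=> //; apply/imsetP; exists (w, q); rewrite // inS bw.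
Qed.

End Count.

Lemma qorbits0 K sq : qorbits K sq 0 = 1%N.
Proof.
have e : qset K 0 = [set ((set0, set0), (set0, set0))].
  apply/setP => -[[A B] [C D]]; rewrite !inE; apply/andP/eqP.
    case=> _; rewrite /qsize /ysize /= !addn_eq0 !cards_eq0.
    by case/andP => /andP[/eqP -> /eqP ->] /andP[/eqP -> /eqP ->].
  case=> -> -> -> ->; rewrite /qyoung /qsize /ysize /= !young_set0.
  by rewrite !cards0.
by rewrite /qorbits e imset_set1 cards1.
Qed.

(** * Arithmetic of the four cases *)

Lemma sum_widths (V : nmodType) (F : nat -> V) (P : pred nat) M s C :
  (s < M)%N -> (C <= s)%N -> (forall w, (w < M)%N -> P w -> (w <= s)%N) ->
  (forall c, (c <= s)%N -> P (s - c)%N = (c <= C)%N) ->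
  \sum_(w < M | P w) F w = \sum_(0 <= c < C.+1) F (s - c)%N.
Proof.
move=> sM Cs Ps PC; rewrite -(big_mkord P F).
rewrite (big_nat_widen 0 C.+1 s.+1) // [RHS]big_nat_rev /=.
rewrite (big_cat_nat (n := s.+1)) //= [X in _ + X]big_nat_cond.
rewrite [X in _ + X]big1 ?addr0; last first.
  by move=> w /andP[/andP[h1 h2] /(Ps _ h2)]; lia.
rewrite big_nat_cond [RHS]big_nat_cond; apply: eq_big => w.
  case: (ltnP w s.+1) => ws; rewrite ?andbF //= add0n subSS.
  by have := PC (s - w)%N; rewrite subKn // => ->; lia.
by move=> /andP[/andP[_ ws] _]; congr F; lia.
Qed.

Lemma leq_sqrt (R : realType) (x : R) c : 0 <= x ->
  (c%:R <= Num.sqrt x) = ((c ^ 2)%:R <= x).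
Proof.
by move=> x0; rewrite -ler_sqr ?nnegrE ?ler0n ?sqrtr_ge0 // sqr_sqrtr // natrX.
Qed.

Lemma truncn_sqrt (R : realType) n (s := Num.truncn (Num.sqrt (n%:R : R))) :
  (s ^ 2 <= n < s.+1 ^ 2)%N.
Proof.
have h c : (c <= s)%N = (c ^ 2 <= n)%N.
  by rewrite /s truncn_ge_nat ?sqrtr_ge0 // leq_sqrt // ler_nat.
by rewrite -h leqnn ltnNge -h ltnn.
Qed.

Lemma ceil_2sqrt (R : realType) n : (0 < n)%N ->
  exists M : nat, [/\ Num.ceil (2 * Num.sqrt (n%:R : R)) = M%:Z,
    (M.-1 ^ 2 < 4 * n)%N & (4 * n <= M ^ 2)%N].
Proof.
move=> n0; set x := Num.sqrt (n%:R : R).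
have x2 : x ^+ 2 = n%:R by rewrite sqr_sqrtr.
have x0 : 0 < x by rewrite sqrtr_gt0 ltr0n.
have y0 : 0 < 2 * x by rewrite mulr_gt0.
have y2 : (2 * x) ^+ 2 = (4 * n)%:R by rewrite exprMn x2 -natrX natrM.
have /andP[h1 h2] := ceil_itv (2 * x); set m := Num.ceil (2 * x) in h1 h2 *.
have m0 : 0 < m by rewrite -(ltr0z R); exact: lt_le_trans h2.
exists `|m|%N; have em : m = `|m|%N%:Z by lia.
split=> //.
  rewrite -(ltr_nat R) -y2 natrX ltr_sqr ?nnegrE ?ler0n ?(ltW y0) //.
  by rewrite (_ : `|m|%N.-1%:R = (m - 1)%:~R) // pmulrn; congr intmul; lia.
rewrite -(ler_nat R) -y2 natrX ler_sqr ?nnegrE ?ler0n ?(ltW y0) //.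
by rewrite (_ : `|m|%N%:R = m%:~R) // [in RHS]em.
Qed.

Lemma box_area_even s c : (c <= s)%N ->
  ((s - c) * (2 * s - (s - c)) + c ^ 2 = s ^ 2)%N.
Proof.
move=> cs; have [w ->] : exists w, s = (w + c)%N by exists (s - c)%N; lia.
rewrite addnK (_ : 2 * (w + c) - w = w + 2 * c)%N; last by lia.
by clear; ring.
Qed.

Lemma box_area_odd s c : (c <= s)%N ->
  ((s - c) * ((2 * s).+1 - (s - c)) + c ^ 2 + c = s ^ 2 + s)%N.
Proof.
move=> cs; have [w ->] : exists w, s = (w + c)%N by exists (s - c)%N; lia.
rewrite addnK (_ : (2 * (w + c)).+1 - w = w + 2 * c + 1)%N; last by lia.
by clear; ring.
Qed.

Theorem theorem1 (R : realType) (n : nat) (n_gt0 : (0 < n)%N) :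
  let s : nat := Num.truncn (Num.sqrt (n%:R : R)) in
  (min_perimeter n)%:Z = 2 * Num.ceil (2 * Num.sqrt (n%:R : R)) /\
  [/\ n = (s ^ 2)%N -> num_min_polyominoes n = 1%N,
      forall t : nat, n = (s ^ 2 + t)%N -> (0 < t < s)%N ->
        (num_min_polyominoes n)%:R =
        \sum_(0 <= c < (Num.truncn (- (1 / 2) + 1 / 2 *
                Num.sqrt (1 + 4 * s%:R - 4 * t%:R) : R)).+1)
          fps_coef r_series (s - c - c ^ 2 - t),
      n = (s ^ 2 + s)%N -> num_min_polyominoes n = 1%N
    & forall t : nat, n = (s ^ 2 + s + t)%N -> (0 < t <= s)%N ->
        (num_min_polyominoes n)%:R =
        fps_coef q_series (s + 1 - t) +
        \sum_(1 <= c < (Num.truncn (Num.sqrt (s%:R + 1 - t%:R : R))).+1)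
          fps_coef r_series (s + 1 - c ^ 2 - t)].
Proof.
move=> s; have /andP[] := truncn_sqrt R n; rewrite -/s; move: s => s s_le s_gt.
have [M [-> M_low M_up]] := ceil_2sqrt R n_gt0.
have M_uniq m : (m ^ 2 < 4 * n)%N -> (4 * n <= m.+1 ^ 2)%N -> M = m.+1.
  move=> h1 h2; have : (m < M)%N by rewrite -ltn_sqr; exact: leq_trans h1 M_up.
  have : (M.-1 < m.+1)%N by rewrite -ltn_sqr; exact: leq_trans M_low h2.
  by lia.
split; first by rewrite (min_perimeterE n_gt0 M_low M_up) PoszM.
have := num_min_polyominoesE n_gt0 M_low M_up; rewrite /box_width.
set F := fun w => qorbits M (w == M - w)%N (w * (M - w) - n)%N.
set P := fun w => (2 * w <= M)%N && (n <= w * (M - w))%N => numE.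
have numE' : num_min_polyominoes n = \sum_(w < M | P w) F w by exact: numE.
have s0 : (0 < s)%N by case: (s) s_gt => //; lia.
have Ps w' w : (M <= 2 * w' + 1)%N -> (w < M)%N -> P w -> (w <= w')%N.
  by move=> h _ /andP[]; lia.
have sq2 m : ((2 * m) ^ 2 = 4 * m ^ 2)%N by rewrite expnMn.
have sq21 m : ((2 * m).+1 ^ 2 = 4 * m ^ 2 + 4 * m + 1)%N by clear; ring.
have sqS m : (m.+1 ^ 2 = m ^ 2 + 2 * m + 1)%N by clear; ring.
have le_sq m : (m <= m ^ 2)%N by case: m => // m; rewrite sqS; lia.
split.
- move=> en; have eM : M = (2 * s)%N.
    have [m em] : exists m, s = m.+1 by exists s.-1; lia.
    have en' : n = (m ^ 2 + 2 * m + 1)%N by rewrite en em sqS.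
    rewrite (M_uniq (2 * m).+1) ?sq21; [lia | lia |].
    by rewrite (_ : (2 * m).+2 = 2 * m.+1)%N ?sq2 ?sqS; lia.
  (* The box of width [s - c] has area [n - c^2], so only the full square is large enough. *)
  have PE c : (c <= s)%N -> P (s - c)%N = (c <= 0)%N.
    move=> cs; have := box_area_even cs; rewrite /P eM => area.
    by have := le_sq c; lia.
  rewrite numE' (@sum_widths _ F P M s 0) ?big_nat1 ?subn0 //; try by lia.
  + rewrite /F (_ : (s * (M - s) - n = 0)%N) ?qorbits0 //.
    by have := box_area_even (leq0n s); rewrite subn0 eM; lia.
  + by move=> w; apply: Ps; lia.
- move=> t en /andP[t0 ts]; have eM : M = (2 * s).+1.
    by apply: M_uniq; rewrite ?sq2 ?sq21; lia.
  set C := Num.truncn _.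
  have CE c : (c <= C)%N = (c + c ^ 2 + t <= s)%N.
    have z0 : 0 <= 1 + 4 * s%:R - 4 * t%:R :> R.
      by have : t%:R <= s%:R :> R by [rewrite ler_nat ltnW]; lra.
    have z1 : 1%:R <= Num.sqrt (1 + 4 * s%:R - 4 * t%:R : R).
      by rewrite leq_sqrt //; have : t%:R <= s%:R :> R by [rewrite ler_nat ltnW]; lra.
    rewrite truncn_ge_nat; last by lra.
    (* Squaring [2 c + 1 <= sqrt (1 + 4 s - 4 t)] gives [c + c^2 + t <= s]: the box of width [s - c]
       has room for [n] cells. *)
    transitivity ((2 * c).+1%:R <= Num.sqrt (1 + 4 * s%:R - 4 * t%:R : R)).
      by rewrite -[(2 * c).+1%:R]natr1 natrM; apply/idP/idP; lra.
    rewrite leq_sqrt // sq21 lerBrDr.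
    have -> : 1 + 4 * s%:R = (1 + 4 * s)%:R :> R by rewrite natrD natrM.
    by rewrite -natrM -natrD ler_nat; lia.
  have PE c : (c <= s)%N -> P (s - c)%N = (c <= C)%N.
    by move=> cs; have := box_area_odd cs; rewrite CE /P eM => area; lia.
  have Cs : (C <= s)%N by have := CE C; lia.
  rewrite numE' (@sum_widths _ F P M s C) //; try by lia.
    rewrite natr_sum big_nat_cond [RHS]big_nat_cond.
    apply: eq_bigr => c /andP[/andP[_ cC] _]; have := CE c; rewrite -ltnS cC => /esym cs.
    have := @box_area_odd s c; rewrite /F eM => area.
    (* The sides add up to an odd number, so no box is a square. *)
    rewrite (_ : (_ == _) = false); last by lia.
    rewrite -(@qorbits_false M); last by lia.
    by congr (qorbits _ _ _)%:R; lia.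
  by move=> w; apply: Ps; lia.
- move=> en; have eM : M = (2 * s).+1.
    by apply: M_uniq; rewrite ?sq2 ?sq21; lia.
  have PE c : (c <= s)%N -> P (s - c)%N = (c <= 0)%N.
    move=> cs; have := box_area_odd cs; rewrite /P eM => area.
    by have := le_sq c; lia.
  rewrite numE' (@sum_widths _ F P M s 0) ?big_nat1 ?subn0 //; try by lia.
  + rewrite /F (_ : (s * (M - s) - n = 0)%N) ?qorbits0 //.
    by have := box_area_odd (leq0n s); rewrite subn0 eM; lia.
  + by move=> w; apply: Ps; lia.
- move=> t en /andP[t0 ts]; have eM : M = (2 * s.+1)%N.
    rewrite (M_uniq (2 * s).+1) ?sq21; [lia | lia |].
    by rewrite (_ : (2 * s).+2 = 2 * s.+1)%N ?sq2 ?sqS; lia.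
  set C := Num.truncn _.
  have CE c : (c <= C)%N = (c ^ 2 + t <= s.+1)%N.
    have z0 : 0 <= s%:R + 1 - t%:R :> R.
      by have : t%:R <= s%:R :> R by [rewrite ler_nat]; lra.
    rewrite truncn_ge_nat ?sqrtr_ge0 // leq_sqrt // lerBrDr -natrD natr1 ler_nat.
    by [].
  have PE c : (c <= s.+1)%N -> P (s.+1 - c)%N = (c <= C)%N.
    by move=> cs; have := box_area_even cs; rewrite CE /P eM => area; lia.
  have Cs : (C <= s)%N by have := CE C; have := le_sq C; lia.
  rewrite numE' (@sum_widths _ F P M s.+1 C) //; try by lia.
    rewrite natr_sum big_ltn //; congr (_ + _).
      (* The widths are now [s.+1 - c], and [c = 0] gives the square box with its full symmetry
         group. *)
      rewrite /F subn0 eM (_ : (_ == _) = true); last by lia.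
      rewrite -(@qorbits_true M); last by lia.
      have := box_area_even (leq0n s.+1); rewrite subn0 => area.
      by rewrite eM; congr (qorbits _ _ _)%:R; lia.
    rewrite big_nat_cond [RHS]big_nat_cond.
    apply: eq_bigr => c /andP[/andP[c0 cC] _]; have := CE c; rewrite -ltnS cC => /esym cs.
    have := @box_area_even s.+1 c; rewrite /F eM => area.
    rewrite (_ : (_ == _) = false); last by lia.
    rewrite -(@qorbits_false M); last by lia.
    by rewrite eM; congr (qorbits _ _ _)%:R; lia.
  by move=> w; apply: Ps; lia.
Qed.
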